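(* Let $\mathbb{F}$ be an infinite division ring and let $\sigma$ be an inner automorphism of $\mathbb{F}$, i.e. $\sigma(a)=u^{-1}au$ for all $a\in\mathbb{F}$, for some $u\in\mathbb{F}^*$. Non-zero skew polynomials $f,g\in\mathbb{F}[x;\sigma]=\mathbb{F}[x;\sigma,0]$ have a common right root in some polynomial ring extension $\tilde{\mathbb{F}}[x;\tilde\sigma]=\tilde{\mathbb{F}}[x;\tilde\sigma,0]$ of $\mathbb{F}[x;\sigma]$ if and only if $R^{\sigma,0}_{\mathbb{F}}(f,g)=0$.
   Context: For a division ring $\mathbb{F}$ and a ring endomorphism $\sigma$ of $\mathbb{F}$, the skew polynomial ring $\mathbb{F}[x;\sigma]=\mathbb{F}[x;\sigma,0]$ is the set of polynomials $\sum_i a_ix^i$ ($a_i\in\mathbb{F}$) with usual addition and multiplication determined by $xa=\sigma(a)x$ for $a\in\mathbb{F}$. The right evaluation $f(a)\in\mathbb{F}$ of $f$ at $a\in\mathbb{F}$ is the unique remainder of the right division of $f$ by $x-a$ ($f=q\cdot(x-a)+f(a)$); $a$ is a right root of $f$ if $f(a)=0$. A polynomial ring extension $\tilde{\mathbb{F}}[x;\tilde\sigma]$ of $\mathbb{F}[x;\sigma]$ is a skew polynomial ring over a division ring $\tilde{\mathbb{F}}$, with $\tilde\sigma$ a ring endomorphism of $\tilde{\mathbb{F}}$, such that $\mathbb{F}$ is a subring of $\tilde{\mathbb{F}}$ and $\tilde\sigma|_{\mathbb{F}}=\sigma$. Having a common right root in it means that there is $\alpha\in\tilde{\mathbb{F}}$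 with $f(\alpha)=g(\alpha)=0$, evaluations being taken in $\tilde{\mathbb{F}}[x;\tilde\sigma]$. Right resultant: for $f,g\in\mathbb{F}[x;\sigma]$ of degrees $m,n\ge0$, the right $(\sigma,0)$-Sylvester matrix is the $(m+n)\times(m+n)$ matrix over $\mathbb{F}$ whose rows are, in order, the vectors of left coefficients with respect to $1,x,\dots,x^{m+n-1}$ of $f,xf,\dots,x^{n-1}f,g,xg,\dots,x^{m-1}g$. $R^{\sigma,0}_{\mathbb{F}}(f,g)$ is its Dieudonné determinant, with values in $\{0\}\cup\mathbb{F}^*/[\mathbb{F}^*,\mathbb{F}^*]$, equal to $0$ exactly when the matrix is singular. *)

(* Defs.v *)
From HB Require Import structures.
From mathcomp Require Import all_boot all_algebra generic_quotient.
From mathcomp Require Import boolp classical_sets cardinality.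

Set Implicit Arguments.
Unset Strict Implicit.
Unset Printing Implicit Defensive.

Import GRing.Theory.
Local Open Scope ring_scope.
Local Open Scope quotient_scope.

HB.mixin Record UnitRing_isDivRing R of GRing.UnitRing R := {
  divring_axiom : forall x : R, x != 0 -> x \is a GRing.unit
}.

#[short(type="divRingType")]
HB.structure Definition DivRing :=
  {R of UnitRing_isDivRing R & GRing.UnitRing R}.

(* An alias of {poly R} carrying the twisted product. As a polynomial, an
   element p is read with its coefficients on the left: p = \sum_i p`_i x^i. *)
Definition skewpoly (R : nzRingType) (s : {rmorphism R -> R}) := {poly R}.

Section SkewPolynomials.

Variables (R : nzRingType) (s : {rmorphism R -> R}).

Local Notation skewpoly := (skewpoly s).

HB.instance Definition _ := GRing.Zmodule.copy skewpoly {poly R}.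

Implicit Types (p q r f : skewpoly) (a c : R).

(* (p_j x^j) (q_k x^k) = p_j s^j(q_k) x^(j + k) *)
Definition skewmul p q : skewpoly :=
  \poly_(i < (size p + size q).-1)
    \sum_(j < i.+1) p`_j * iter j s q`_(i - j).

Lemma iters_additive n : {morph iter n s : a c / a + c}.
Proof. by elim: n => //= n IHn a c; rewrite !iterS IHn rmorphD. Qed.

Lemma iters_multiplicative n : {morph iter n s : a c / a * c}.
Proof. by elim: n => //= n IHn a c; rewrite !iterS IHn rmorphM. Qed.

Lemma iters0 n : iter n s 0 = 0.
Proof. by elim: n => //= n ->; rewrite rmorph0. Qed.

Lemma iters1 n : iter n s 1 = 1.
Proof. by elim: n => //= n ->; rewrite rmorph1. Qed.

Lemma iters_sum n (I : Type) (t : seq I) (P : pred I) (F : I -> R) :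
  iter n s (\sum_(i <- t | P i) F i) = \sum_(i <- t | P i) iter n s (F i).
Proof. exact: (big_morph _ (iters_additive n) (iters0 n)). Qed.

Lemma coef_skewmul p q i :
  (skewmul p q)`_i = \sum_(j < i.+1) p`_j * iter j s q`_(i - j).
Proof.
rewrite coef_poly ltn_predRL; case: leqP => // le_pq_i1.
rewrite big1 // => j _; have [lq_p_j|lt_j_p] := leqP (size p) j.
  by rewrite nth_default ?mul0r.
rewrite [q`__]nth_default ?iters0 ?mulr0 // leq_subRL -ltnS //.
by rewrite (leq_trans _ le_pq_i1) // ltn_add2r.
Qed.

Lemma coef_skewmul_rev p q i :
  (skewmul p q)`_i = \sum_(j < i.+1) p`_(i - j) * iter (i - j) s q`_j.
Proof.
rewrite coef_skewmul (reindex_inj rev_ord_inj) /=.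
by apply: eq_bigr => j _; rewrite (sub_ordK j).
Qed.

Lemma skewmulA : associative skewmul.
Proof.
move=> p q r; apply/polyP=> i; rewrite coef_skewmul coef_skewmul_rev.
pose coef3 j k := p`_j * (iter j s q`_(i - j - k) * iter (i - k) s r`_k).
transitivity (\sum_(j < i.+1) \sum_(k < i.+1 | (k <= i - j)%N) coef3 j k).
  apply: eq_bigr => /= j _; rewrite coef_skewmul_rev iters_sum big_distrr /=.
  rewrite (big_ord_narrow_leq (leq_subr _ _)); apply: eq_bigr => k _ /=.
  rewrite /coef3 iters_multiplicative -iterD; congr (_ * (_ * iter _ s _)).
  rewrite addnBA; last by rewrite -ltnS ltn_ord.
  by rewrite subnKC // -ltnS ltn_ord.
rewrite (exchange_big_dep predT) //=; apply: eq_bigr => k _.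
transitivity (\sum_(j < i.+1 | (j <= i - k)%N) coef3 j k).
  apply: eq_bigl => j; rewrite -ltnS -(ltnS j) -!subSn ?leq_ord //.
  by rewrite -subn_gt0 -(subn_gt0 j) -!subnDA addnC.
rewrite (big_ord_narrow_leq (leq_subr _ _)) coef_skewmul big_distrl /=.
by apply: eq_bigr => j _; rewrite /coef3 -!subnDA addnC mulrA.
Qed.

Lemma skewmul1p : left_id (1%:P : skewpoly) skewmul.
Proof.
move=> p; apply/polyP => i; rewrite coef_skewmul big_ord_recl subn0.
by rewrite big1 => [|j _]; rewrite coefC /= ?mul0r // mul1r addr0.
Qed.

Lemma skewmulp1 : right_id (1%:P : skewpoly) skewmul.
Proof.
move=> p; apply/polyP => i; rewrite coef_skewmul_rev big_ord_recl subn0.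
rewrite big1 => [|j _]; rewrite coefC /= ?iters0 ?mulr0 //.
by rewrite iters1 mulr1 addr0.
Qed.

Lemma skewmulDl : left_distributive skewmul +%R.
Proof.
move=> p q r; apply/polyP=> i; rewrite coefD !coef_skewmul -big_split.
by apply: eq_bigr => j _; rewrite coefD mulrDl.
Qed.

Lemma skewmulDr : right_distributive skewmul +%R.
Proof.
move=> p q r; apply/polyP=> i; rewrite coefD !coef_skewmul -big_split.
by apply: eq_bigr => j _; rewrite coefD iters_additive mulrDr.
Qed.

Lemma skewpoly1_neq0 : (1%:P : skewpoly) != 0.
Proof. by rewrite polyC_eq0 oner_neq0. Qed.

HB.instance Definition _ := GRing.Zmodule_isNzRing.Build skewpoly
  skewmulA skewmul1p skewmulp1 skewmulDl skewmulDr skewpoly1_neq0.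

Definition skewX : skewpoly := 'X.
Definition skewC (a : R) : skewpoly := a%:P.

Lemma coef_skewM p q i :
  (p * q)`_i = \sum_(j < i.+1) p`_j * iter j s q`_(i - j).
Proof. exact: coef_skewmul. Qed.

Lemma coef_skewMr p q i :
  (p * q)`_i = \sum_(j < i.+1) p`_(i - j) * iter (i - j) s q`_j.
Proof. exact: coef_skewmul_rev. Qed.

Lemma coef_skewCM a p i : (skewC a * p)`_i = a * p`_i.
Proof.
rewrite coef_skewM big_ord_recl /= coefC eqxx subn0 big1 ?addr0 // => j _.
by rewrite coefC mul0r.
Qed.

Lemma coef_skewMX p i : (p * skewX)`_i = if i is i'.+1 then p`_i' else 0.
Proof.
rewrite coef_skewMr; case: i => [|i].
  by rewrite big_ord1 coefX iters0 mulr0.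
rewrite big_ord_recl big_ord_recl coefX iters0 mulr0 add0r.
rewrite coefX iters1 mulr1 subSS subn0 big1 ?addr0 // => j _.
by rewrite coefX iters0 mulr0.
Qed.

Lemma coef_skewMC p a i : (p * skewC a)`_i = p`_i * iter i s a.
Proof.
rewrite coef_skewMr big_ord_recl /= coefC eqxx subn0 big1 ?addr0 // => j _.
by rewrite coefC iters0 mulr0.
Qed.

Lemma skewXC a : skewX * skewC a = skewC (s a) * skewX.
Proof.
apply/polyP => i; rewrite coef_skewMC coef_skewMX coefX.
case: i => [|[|i]] /=; rewrite ?mul0r ?coefC //=; exact: mul1r.
Qed.

Lemma coef_skewXn n i : (skewX ^+ n)`_i = (i == n)%:R.
Proof.
elim: n i => [|n IHn] i; first by rewrite expr0 coefC; case: eqP.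
by rewrite exprSr coef_skewMX; case: i.
Qed.

Lemma skewpolyE f : f = \sum_(i < size f) skewC f`_i * skewX ^+ i.
Proof.
apply/polyP => k; rewrite (big_morph (fun g : skewpoly => g`_k)
  (fun g h => coefD g h k) (coef0 R k)).
under eq_bigr => i _ do rewrite coef_skewCM coef_skewXn.
have [lt_k|le_k] := ltnP k (size f).
  rewrite (bigD1 (Ordinal lt_k)) //= eqxx mulr1 big1 ?addr0 // => i.
  by rewrite -val_eqE /= eq_sym => /negPf->; rewrite mulr0.
rewrite nth_default // big1 // => i _; case: eqP => [E|_]; last exact: mulr0.
by rewrite E leqNgt ltn_ord in le_k.
Qed.

Lemma skewC0 : skewC 0 = 0. Proof. exact: polyC0. Qed.

Lemma skewCD a b : skewC (a + b) = skewC a + skewC b.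
Proof. exact: polyCD. Qed.

Lemma skewCB a b : skewC (a - b) = skewC a - skewC b.
Proof. exact: polyCB. Qed.

Lemma skewCM a b : skewC (a * b) = skewC a * skewC b.
Proof.
by apply/polyP => i; rewrite coef_skewCM !coefC; case: eqP; rewrite ?mulr0.
Qed.

Lemma skew_remainder_ex f a :
  exists c, exists q, f = q * (skewX - skewC a) + skewC c.
Proof.
have Xn n : exists c, exists q,
    skewX ^+ n = q * (skewX - skewC a) + skewC c.
  elim: n => [|n [c [q E]]].
    by exists 1, 0; rewrite mul0r add0r.
  exists (s c * a), (skewX * q + skewC (s c)).
  rewrite exprS E mulrDr skewXC mulrDl mulrA -addrA; congr (_ + _).
  by rewrite mulrBr skewCM subrK.
rewrite (skewpolyE f); elim/big_rec: _ => [|i g _ [d [r ->]]].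
  by exists 0, 0; rewrite mul0r add0r skewC0.
have [c [q ->]] := Xn i; exists (f`_i * c + d), (skewC f`_i * q + r).
by rewrite mulrDr mulrDl mulrA skewCD skewCM addrACA.
Qed.

Lemma skew_remainder_uniq a (q q' : skewpoly) c c' :
  q * (skewX - skewC a) + skewC c = q' * (skewX - skewC a) + skewC c' ->
  q = q' /\ c = c'.
Proof.
move=> E; have {}E : (q - q') * (skewX - skewC a) = skewC (c' - c).
  rewrite mulrBl skewCB; apply/eqP; rewrite subr_eq addrAC -subr_eq opprK.
  by rewrite E addrC.
have q0 : q - q' = 0.
  apply/eqP/negPn/negP => nz_q.
  pose n := (size (q - q')).-1.
  have sz : size (q - q') = n.+1 by rewrite /n polySpred.
  have : ((q - q') * (skewX - skewC a))`_n.+1 = 0 by rewrite E coefC.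
  rewrite mulrBr coefB coef_skewMX coef_skewMC.
  rewrite [X in _ - X * _]nth_default ?sz // mul0r subr0 => /eqP.
  by rewrite -[_`_n]/(lead_coef (q - q')) lead_coef_eq0 (negPf nz_q).
split; first by apply/eqP; rewrite -subr_eq0 q0.
move: E; rewrite q0 mul0r => /polyP/(_ 0); rewrite coef0 coefC /= => /eqP.
by rewrite eq_sym subr_eq0 => /eqP.
Qed.

Definition right_eval f a : R := sval (cid (skew_remainder_ex f a)).

Lemma right_evalP f a c :
  right_eval f a = c <-> exists q, f = q * (skewX - skewC a) + skewC c.
Proof.
rewrite /right_eval; case: cid => d [q E] /=; split=> [<-|[q' E']].
  by exists q.
by have [] := skew_remainder_uniq (etrans (esym E) E').
Qed.

Definition skew_degree f : nat := (size f).-1.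

Definition right_sylvester f g :
    'M[R]_(skew_degree f + skew_degree g) :=
  \matrix_(i, j)
    if (i < skew_degree g)%N then (skewX ^+ i * f)`_j
    else (skewX ^+ (i - skew_degree g) * g)`_j.

End SkewPolynomials.

Definition skewpoly_map (R S : nzRingType)
    (s : {rmorphism R -> R}) (t : {rmorphism S -> S})
    (h : {rmorphism R -> S}) (f : skewpoly s) : skewpoly t :=
  map_poly h f.
Arguments skewpoly_map {R S s} t h f.

Lemma skewpoly_mapM (R S : nzRingType)
    (s : {rmorphism R -> R}) (t : {rmorphism S -> S})
    (h : {rmorphism R -> S}) (f g : skewpoly s) :
    (forall a, t (h a) = h (s a)) ->
  skewpoly_map t h (f * g) = skewpoly_map t h f * skewpoly_map t h g.
Proof.
move=> th; have thn n a : iter n t (h a) = h (iter n s a).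
  by elim: n => //= n ->.
apply/polyP => i; rewrite coef_map /= !coef_skewM rmorph_sum.
by apply: eq_bigr => j _ /=; rewrite !coef_map rmorphM thn.
Qed.

Lemma divring_morph_inj (F : divRingType) (S : nzRingType)
  (h : {rmorphism F -> S}) : injective h.
Proof.
move=> a b /eqP; rewrite -subr_eq0 -rmorphB => /eqP hab0.
apply/eqP; rewrite -subr_eq0; apply/negPn/negP => /divring_axiom/mulVr.
by move/(congr1 h)/eqP; rewrite rmorphM hab0 mulr0 rmorph1 eq_sym oner_eq0.
Qed.

Section DieudonneDeterminant.

Variable F : divRingType.

Inductive commutator_subgroup : F -> Prop :=
| CommSubgroup_commutator a b of a != 0 & b != 0 :
    commutator_subgroup (a^-1 * b^-1 * a * b)
| CommSubgroup1 : commutator_subgroup 1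
| CommSubgroupM a b of commutator_subgroup a & commutator_subgroup b :
    commutator_subgroup (a * b)
| CommSubgroupV a of commutator_subgroup a : commutator_subgroup a^-1.

Lemma commutator_subgroup_unit a : commutator_subgroup a -> a \is a GRing.unit.
Proof.
elim=> [b c nz_b nz_c||b c _ Ub _ Uc|b _ Ub].
- by rewrite !unitrMr ?unitrV ?divring_axiom.
- exact: unitr1.
- by rewrite unitrMr.
- by rewrite unitrV.
Qed.

Definition comm_equiv (x y : F) : bool :=
  `[< exists2 c, commutator_subgroup c & x = y * c >].

Lemma comm_equiv_refl : reflexive comm_equiv.
Proof.
by move=> x; apply/asboolP; exists 1; [exact: CommSubgroup1 | rewrite mulr1].
Qed.

Lemma comm_equiv_sym : symmetric comm_equiv.
Proof.
have H x y : comm_equiv x y -> comm_equiv y x.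
  move=> /asboolP[c Cc ->]; apply/asboolP; exists c^-1.
    exact: CommSubgroupV.
  by rewrite mulrK // commutator_subgroup_unit.
by move=> x y; apply/idP/idP; apply: H.
Qed.

Lemma comm_equiv_trans : transitive comm_equiv.
Proof.
move=> y x z /asboolP[c Cc ->] /asboolP[d Cd ->]; apply/asboolP.
by exists (d * c); [exact: CommSubgroupM | rewrite mulrA].
Qed.

Canonical comm_equiv_equiv :=
  EquivRel comm_equiv comm_equiv_refl comm_equiv_sym comm_equiv_trans.

(* {0} \cup F^* / [F^*, F^*], obtained as the quotient of the whole of F by the
   cosets x [F^*, F^*]: the class of 0 is {0}, see dieudonne_class_eq0. *)
Definition dieudonne_value := {eq_quot comm_equiv}.

Definition dieudonne_class (x : F) : dieudonne_value := \pi_dieudonne_value x.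

Definition dieudonne_zero : dieudonne_value := dieudonne_class 0.

Lemma dieudonne_classP x y :
  dieudonne_class x = dieudonne_class y <->
  exists2 c, commutator_subgroup c & x = y * c.
Proof.
split=> [/eqmodP/asboolP//|H].
by apply/eqmodP; apply/asboolP.
Qed.

Lemma dieudonne_class_eq0 x : dieudonne_class x = dieudonne_zero <-> x = 0.
Proof.
split=> [/dieudonne_classP[c _ ->]|->//].
by rewrite mul0r.
Qed.

(* Gaussian elimination by left multiplication with transvections: the first
   nonzero entry A i 0 of column 0 is the pivot, its row is moved to the top
   (sign (-1)^i) and the other entries of column 0 are cleared. This gives a
   representative; its class does not depend on the choice of the pivots. *)
Fixpoint dieudonne_rep (n : nat) : 'M[F]_n -> F :=
  match n return 'M[F]_n -> F with
  | 0 => fun=> 1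
  | n'.+1 => fun A =>
      if [pick i | A i 0 != 0] is Some i then
        (-1) ^+ i * A i 0 *
        dieudonne_rep (\matrix_(k < n', j < n')
          (A (lift i k) (lift 0 j)
             - A (lift i k) 0 * (A i 0)^-1 * A i (lift 0 j)))
      else 0
  end.

Definition dieudonne_det (n : nat) (A : 'M[F]_n) : dieudonne_value :=
  dieudonne_class (dieudonne_rep A).

Lemma dieudonne_det_eq0 n (A : 'M[F]_n) :
  dieudonne_det A = dieudonne_zero <->
  exists2 v : 'cV[F]_n, v != 0 & A *m v = 0.
Proof.
rewrite /dieudonne_det dieudonne_class_eq0.
elim: n A => [|n IHn] A /=.
  split=> [/eqP|[v]]; first by rewrite oner_eq0.
  by rewrite flatmx0 eqxx.
case: pickP => [i nz_i|col0]; last first.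
  split=> // _; exists (delta_mx 0 0).
    apply/eqP => /matrixP/(_ 0 0); rewrite !mxE !eqxx => /eqP.
    by rewrite oner_eq0.
  by rewrite -colE; apply/matrixP => k j; rewrite !mxE; apply/eqP/negPn;
    rewrite col0.
set S := \matrix_(k, j) _; set a := A i 0 in S nz_i *.
have Ua : a \is a GRing.unit by exact: divring_axiom.
have -> : (-1) ^+ i * a * dieudonne_rep S = 0 <-> dieudonne_rep S = 0.
  split=> [|->]; last by rewrite mulr0.
  have U : (-1) ^+ i * a \is a GRing.unit.
    by rewrite unitrMr // unitrX // unitrN1.
  by move/(congr1 ( *%R ((-1) ^+ i * a)^-1)); rewrite mulKr // mulr0.
rewrite {}IHn.
pose w' (v : 'cV[F]_n.+1) : 'cV[F]_n := \col_j v (lift 0 j) 0.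
pose r (w : 'cV[F]_n) := \sum_j A i (lift 0 j) * w j 0.
have AvE v k : (A *m v) k 0 =
    A k 0 * v 0 0 + \sum_j A k (lift 0 j) * w' v j 0.
  by rewrite mxE big_ord_recl; congr (_ + _); apply: eq_bigr => j _; rewrite mxE.
have SwE w k : (S *m w) k 0 =
    \sum_j A (lift i k) (lift 0 j) * w j 0 - A (lift i k) 0 * a^-1 * r w.
  rewrite mxE /r mulr_sumr -sumrB; apply: eq_bigr => j _.
  by rewrite mxE mulrBl !mulrA.
split=> [[w nz_w Sw0]|[v nz_v Av0]].
  pose v : 'cV[F]_n.+1 := \col_j (if unlift 0 j is Some j' then w j' 0
                                  else - (a^-1 * r w)).
  have w'v : w' v = w.
    by apply/matrixP => j o; rewrite !mxE liftK ord1.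
  have v00 : v 0 0 = - (a^-1 * r w) by rewrite mxE unlift_none.
  exists v.
    apply: contraNneq nz_w => v0; rewrite -w'v v0.
    by apply/eqP/matrixP => j o; rewrite !mxE.
  apply/matrixP => k o; rewrite ord1 AvE w'v v00 [RHS]mxE.
  case: (unliftP i k) => [k'|] ->.
    have := SwE w k'; rewrite Sw0 mxE => /esym E0.
    by rewrite mulrN addrC mulrA.
  by rewrite mulrN mulVKr // addNr.
have v00 : v 0 0 = - (a^-1 * r (w' v)).
  have := AvE v i; rewrite Av0 mxE -/a -/(r (w' v)) => /esym/eqP.
  by rewrite addr_eq0 => /eqP/(congr1 ( *%R a^-1)); rewrite mulKr // mulrN.
exists (w' v).
  apply: contraNneq nz_v => w0; apply/eqP/matrixP => k o; rewrite ord1 !mxE.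
  case: (unliftP 0 k) => [k'|] ->.
    by have := congr1 (fun w : 'cV_n => w k' 0) w0; rewrite !mxE.
  by rewrite v00 w0 /r big1 ?mulr0 ?oppr0 // => j _; rewrite mxE mulr0.
apply/matrixP => k o; rewrite ord1 SwE [RHS]mxE.
have := AvE v (lift i k); rewrite Av0 mxE v00 => /esym E0.
by rewrite addrC mulrN mulrA in E0.
Qed.

Definition right_resultant (s : {rmorphism F -> F}) (f g : skewpoly s) :
    dieudonne_value :=
  dieudonne_det (right_sylvester f g).

End DieudonneDeterminant.

(* Main.v *)
(* If f and g have a common right root alpha in an extension, the vector of the
   remainders of 1, x, x^2, ... modulo x - alpha is a right kernel vector of the
   Sylvester matrix over the extension, and elimination commutes with the
   embedding of F. Conversely, running the Euclidean algorithm on a pair (f, g)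
   together with a right kernel vector of the Sylvester matrix produces a
   nonconstant common right divisor d, and it remains to give d a right root in
   some extension E[x; t].

   The endomorphism t need not be inner, which makes an elementary construction
   possible. If t extends s and gamma in E^* satisfies sum_i d_i t^i(gamma) = 0,
   then alpha = t(gamma) / gamma is a right root of d. Let D be a division ring
   extension of F with infinite center, and let Om be the set of the sequences w
   in D that annihilate the left ideal generated by d. If d_0 != 0, the shift
   w |-> (u w_(i+1) u^-1)_i maps Om onto itself. Take for E the germs of those
   D-valued functions on Om whose restrictions to the lines w + c v, c central,
   are locally left fractions of polynomials in c: since a nonzero polynomial
   over D has finitely many central roots, two nonempty "Zariski open" subsets of
   Om meet, whence E is a division ring. Composition with the shift, followed by
   conjugation by u, gives t, and gamma is the coordinate w |-> w_0. *)
From HB Require Import structures.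
Require Import Defs.
From mathcomp Require Import all_boot all_algebra.
From mathcomp Require Import zify.
From mathcomp Require Import boolp classical_sets cardinality.

Set Implicit Arguments.
Unset Strict Implicit.
Unset Printing Implicit Defensive.

Import GRing.Theory.
Local Open Scope ring_scope.

(** * Quotient of a division ring up to equivalence *)

Section SetoidQuotient.

(** A division ring presented by representatives: laws are required on [valid] elements and up to
    [eqv], and inverses are merely asserted to exist. Both the Ore fractions and the germs of
    functions arise as quotients of this kind. *)
Record divSetoid := DivSetoid {
  carrier :> Type;
  valid : carrier -> Prop;
  eqv : carrier -> carrier -> Prop;
  szero : carrier;
  sone : carrier;
  sadd : carrier -> carrier -> carrier;
  sopp : carrier -> carrier;
  smul : carrier -> carrier -> carrier;
  eqv_refl : forall x, valid x -> eqv x x;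
  eqv_sym : forall x y, valid x -> valid y -> eqv x y -> eqv y x;
  eqv_trans : forall x y z, valid x -> valid y -> valid z ->
    eqv x y -> eqv y z -> eqv x z;
  valid0 : valid szero;
  valid1 : valid sone;
  validD : forall x y, valid x -> valid y -> valid (sadd x y);
  validN : forall x, valid x -> valid (sopp x);
  validM : forall x y, valid x -> valid y -> valid (smul x y);
  eqvD : forall x x' y y', valid x -> valid x' -> valid y -> valid y' ->
    eqv x x' -> eqv y y' -> eqv (sadd x y) (sadd x' y');
  eqvN : forall x x', valid x -> valid x' -> eqv x x' ->
    eqv (sopp x) (sopp x');
  eqvM : forall x x' y y', valid x -> valid x' -> valid y -> valid y' ->
    eqv x x' -> eqv y y' -> eqv (smul x y) (smul x' y');
  saddA : forall x y z, valid x -> valid y -> valid z ->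
    eqv (sadd x (sadd y z)) (sadd (sadd x y) z);
  saddC : forall x y, valid x -> valid y -> eqv (sadd x y) (sadd y x);
  sadd0 : forall x, valid x -> eqv (sadd szero x) x;
  saddN : forall x, valid x -> eqv (sadd (sopp x) x) szero;
  smulA : forall x y z, valid x -> valid y -> valid z ->
    eqv (smul x (smul y z)) (smul (smul x y) z);
  smul1l : forall x, valid x -> eqv (smul sone x) x;
  smul1r : forall x, valid x -> eqv (smul x sone) x;
  smulDl : forall x y z, valid x -> valid y -> valid z ->
    eqv (smul (sadd x y) z) (sadd (smul x z) (smul y z));
  smulDr : forall x y z, valid x -> valid y -> valid z ->
    eqv (smul x (sadd y z)) (sadd (smul x y) (smul x z));
  sone_neq0 : ~ eqv sone szero;
  sinv : forall x, valid x -> ~ eqv x szero ->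
    exists y, [/\ valid y, eqv (smul x y) sone & eqv (smul y x) sone]
}.

Variable X : divSetoid.

Definition cls (x : X) : set X := [set y | valid y /\ eqv x y].

Record squot := SQuot {
  scls : set X;
  sclsP : exists2 x, valid x & scls = cls x
}.

(** Invalid elements go to the class of zero, a default that keeps the projection total. *)
Definition spi (x : X) : squot :=
  match pselect (valid x) with
  | left vx => SQuot (ex_intro2 _ _ x vx erefl)
  | right _ => SQuot (ex_intro2 _ _ (szero X) (valid0 X) erefl)
  end.

Definition srep (a : squot) : X := s2val (cid2 (sclsP a)).

Lemma srep_valid a : valid (srep a).
Proof. by rewrite /srep; case: cid2. Qed.

Lemma scls_spi x : valid x -> scls (spi x) = cls x.
Proof. by rewrite /spi; case: pselect. Qed.

Lemma squot_eq (a b : squot) : scls a = scls b -> a = b.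
Proof.
case: a b => [A pA] [B pB] /= eAB; case: _ / eAB pB => pB.
by congr SQuot; exact: Prop_irrelevance.
Qed.

Lemma spiP x y : valid x -> valid y -> (spi x = spi y <-> eqv x y).
Proof.
move=> vx vy; split=> [/(congr1 scls)|exy].
  rewrite !scls_spi // => e.
  have : cls y y by split=> //; exact: eqv_refl.
  by rewrite -e => -[].
apply: squot_eq; rewrite !scls_spi //; apply/predeqP => z; split=> -[vz e].
  by split=> //; exact: eqv_trans (eqv_sym vx vy exy) e.
by split=> //; exact: eqv_trans exy e.
Qed.

Lemma srepK a : spi (srep a) = a.
Proof.
apply: squot_eq; rewrite (scls_spi (srep_valid a)).
by rewrite /srep; case: cid2.
Qed.

Lemma srep_eqv x : valid x -> eqv (srep (spi x)) x.
Proof. by move=> vx; apply/spiP => //; [exact: srep_valid|exact: srepK]. Qed.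

Lemma spi_ind (P : squot -> Prop) :
  (forall x, valid x -> P (spi x)) -> forall a, P a.
Proof. by move=> Pspi a; rewrite -(srepK a); apply/Pspi/srep_valid. Qed.

Definition qadd a b := spi (sadd (srep a) (srep b)).
Definition qopp a := spi (sopp (srep a)).
Definition qmul a b := spi (smul (srep a) (srep b)).

Local Hint Resolve valid0 valid1 validD validN validM srep_valid : core.

Lemma qaddE x y : valid x -> valid y -> qadd (spi x) (spi y) = spi (sadd x y).
Proof. by move=> vx vy; apply/spiP; auto; apply: eqvD; auto using srep_eqv. Qed.

Lemma qoppE x : valid x -> qopp (spi x) = spi (sopp x).
Proof. by move=> vx; apply/spiP; auto; apply: eqvN; auto using srep_eqv. Qed.

Lemma qmulE x y : valid x -> valid y -> qmul (spi x) (spi y) = spi (smul x y).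
Proof. by move=> vx vy; apply/spiP; auto; apply: eqvM; auto using srep_eqv. Qed.

Lemma qaddA : associative qadd.
Proof.
elim/spi_ind => x vx; elim/spi_ind => y vy; elim/spi_ind => z vz.
by rewrite !qaddE; auto; apply/spiP; auto; apply: saddA.
Qed.

Lemma qaddC : commutative qadd.
Proof.
elim/spi_ind => x vx; elim/spi_ind => y vy.
by rewrite !qaddE; auto; apply/spiP; auto; apply: saddC.
Qed.

Lemma qadd0 : left_id (spi (szero X)) qadd.
Proof.
elim/spi_ind => x vx; rewrite qaddE; auto.
by apply/spiP; auto; apply: sadd0.
Qed.

Lemma qaddN : left_inverse (spi (szero X)) qopp qadd.
Proof.
elim/spi_ind => x vx; rewrite qoppE ?qaddE; auto.
by apply/spiP; auto; apply: saddN.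
Qed.

Lemma qmulA : associative qmul.
Proof.
elim/spi_ind => x vx; elim/spi_ind => y vy; elim/spi_ind => z vz.
by rewrite !qmulE; auto; apply/spiP; auto; apply: smulA.
Qed.

Lemma qmul1l : left_id (spi (sone X)) qmul.
Proof.
elim/spi_ind => x vx; rewrite qmulE; auto.
by apply/spiP; auto; apply: smul1l.
Qed.

Lemma qmul1r : right_id (spi (sone X)) qmul.
Proof.
elim/spi_ind => x vx; rewrite qmulE; auto.
by apply/spiP; auto; apply: smul1r.
Qed.

Lemma qmulDl : left_distributive qmul qadd.
Proof.
elim/spi_ind => x vx; elim/spi_ind => y vy; elim/spi_ind => z vz.
by rewrite qaddE ?qmulE ?qaddE; auto; apply/spiP; auto; apply: smulDl.
Qed.

Lemma qmulDr : right_distributive qmul qadd.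
Proof.
elim/spi_ind => x vx; elim/spi_ind => y vy; elim/spi_ind => z vz.
by rewrite qaddE ?qmulE ?qaddE; auto; apply/spiP; auto; apply: smulDr.
Qed.

HB.instance Definition _ := gen_eqMixin squot.
HB.instance Definition _ := gen_choiceMixin squot.

Lemma qone_neq0 : spi (sone X) != spi (szero X).
Proof. by apply/eqP => /spiP e; apply: (@sone_neq0 X); apply: e. Qed.

HB.instance Definition _ :=
  GRing.isZmodule.Build squot qaddA qaddC qadd0 qaddN.
HB.instance Definition _ := GRing.Zmodule_isNzRing.Build squot
  qmulA qmul1l qmul1r qmulDl qmulDr qone_neq0.

(** Zero is assigned itself, so that choice yields a total inverse that is the identity off the
    units. *)
Lemma qinv_ex (a : squot) :
  exists b : squot, if a == 0 then b == a else (b * a == 1) && (a * b == 1).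
Proof.
have [->|] := eqVneq a 0; first by exists 0.
elim/spi_ind: a => x vx /eqP nz_x.
have [|y [vy xy yx]] := @sinv X x vx.
  by move=> e; apply: nz_x; apply/spiP.
exists (spi y); apply/andP; split; apply/eqP.
  by rewrite [LHS]qmulE //; apply/spiP; auto.
by rewrite [LHS]qmulE //; apply/spiP; auto.
Qed.

Definition qinv (a : squot) : squot := sval (cid (qinv_ex a)).

Lemma qinvP (a : squot) :
  if a == 0 then qinv a == a else (qinv a * a == 1) && (a * qinv a == 1).
Proof. by rewrite /qinv; case: cid. Qed.

Lemma qmulV : {in [pred a : squot | a != 0], left_inverse 1 qinv *%R}.
Proof.
by move=> a /negPf nz_a; have:= qinvP a; rewrite nz_a => /andP[/eqP].
Qed.

Lemma qmulrV : {in [pred a : squot | a != 0], right_inverse 1 qinv *%R}.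
Proof.
by move=> a /negPf nz_a; have:= qinvP a; rewrite nz_a => /andP[_ /eqP].
Qed.

Lemma qunitP (a b : squot) : b * a = 1 /\ a * b = 1 -> a != 0.
Proof.
move=> [ba _]; apply: contra_eq_neq ba => ->.
by rewrite mulr0 eq_sym oner_eq0.
Qed.

Lemma qinv_out : {in [predC [pred a : squot | a != 0]], qinv =1 id}.
Proof.
by move=> a /negPn a0; have:= qinvP a; rewrite [a == 0]a0 => /eqP.
Qed.

HB.instance Definition _ :=
  GRing.NzRing_hasMulInverse.Build squot qmulV qmulrV qunitP qinv_out.

Lemma squot_unit (a : squot) : a != 0 -> a \is a GRing.unit.
Proof. by []. Qed.

HB.instance Definition _ := UnitRing_isDivRing.Build squot squot_unit.

Lemma spiD x y : valid x -> valid y -> spi (sadd x y) = spi x + spi y.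
Proof. by move=> vx vy; rewrite [RHS]qaddE. Qed.

Lemma spiM x y : valid x -> valid y -> spi (smul x y) = spi x * spi y.
Proof. by move=> vx vy; rewrite [RHS]qmulE. Qed.

End SetoidQuotient.

(** * Left fractions of an Ore domain *)

Section OreFractions.

Variable A : nzRingType.
Hypothesis domA : forall a b : A, a * b = 0 -> a = 0 \/ b = 0.
Hypothesis oreA : forall a b : A, b != 0 ->
  exists c d, c != 0 /\ c * a = d * b.

Let mulf_neq0 (a b : A) : a != 0 -> b != 0 -> a * b != 0.
Proof. by move=> /eqP na /eqP nb; apply/eqP => /domA[]. Qed.

Let mulIf (c a b : A) : c != 0 -> a * c = b * c -> a = b.
Proof.
move=> /eqP nc /eqP; rewrite -subr_eq0 -mulrBl => /eqP/domA[/eqP|//].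
by rewrite subr_eq0 => /eqP.
Qed.

Let mulfI (c a b : A) : c != 0 -> c * a = c * b -> a = b.
Proof.
move=> /eqP nc /eqP; rewrite -subr_eq0 -mulrBr => /eqP/domA[//|/eqP].
by rewrite subr_eq0 => /eqP.
Qed.

(* A pair x with x.1 != 0 stands for the left fraction x.1^-1 x.2, and
   [lfrac x c v] expresses c x = v. *)
Definition lfrac (x : A * A) (c v : A) : Prop :=
  exists e e', [/\ e != 0, e * c = e' * x.1 & e * v = e' * x.2].

Implicit Types x y z : A * A.
Local Notation valid x := (x.1 != 0).

Lemma lfrac_self x : lfrac x x.1 x.2.
Proof. by exists 1, 1; rewrite oner_eq0. Qed.

Lemma lfracZ a x c v : lfrac x c v -> lfrac x (a * c) (a * v).
Proof.
case=> e [e' [nz_e Ec Ev]]; have [p [q [nz_p Epq]]] := oreA a nz_e.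
exists p, (q * e'); split=> //.
  by rewrite mulrA Epq -!mulrA Ec.
by rewrite mulrA Epq -!mulrA Ev.
Qed.

(** Once the two witnesses are brought to a left common multiple, cancelling [x.1] on the right
    identifies their cofactors. *)
Lemma lfrac_fun x c v v' : valid x -> lfrac x c v -> lfrac x c v' -> v = v'.
Proof.
move=> vx [e [e' [nz_e Ec Ev]]] [f [f' [nz_f Fc Fv]]].
have [p [q [nz_p Epq]]] := oreA e nz_f.
apply: (@mulfI (p * e)); first exact: mulf_neq0.
suff Eq : p * e' = q * f' by rewrite -mulrA Ev mulrA Eq Epq -!mulrA Fv.
by apply: (mulIf vx); rewrite -!mulrA -Ec -Fc !mulrA Epq.
Qed.

(** One value at a nonzero [c] determines the whole fraction; hence fractions may be compared at any
    common denominator. *)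
Lemma lfrac_change x c v c' v' : valid x -> c != 0 -> lfrac x c v ->
  lfrac x c' v' <-> lfrac (c, v) c' v'.
Proof.
move=> vx nz_c xcv; split=> [xcv'|[e [e' [/= nz_e Ec Ev]]]].
  have [p [q [nz_p Epq]]] := oreA c' nz_c.
  exists p, q; split=> //=; apply: (lfrac_fun vx (lfracZ p xcv')).
  by rewrite Epq; exact: lfracZ.
case: xcv => f [f' [nz_f Fc Fv]]; have [p [q [nz_p Epq]]] := oreA e' nz_f.
exists (p * e), (q * f'); split; first exact: mulf_neq0.
  by rewrite -mulrA Ec mulrA Epq -!mulrA Fc.
by rewrite -mulrA Ev mulrA Epq -!mulrA Fv.
Qed.

Lemma lfracD x c v c' v' :
  lfrac x c v -> lfrac x c' v' -> lfrac x (c + c') (v + v').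
Proof.
move=> [e [e' [nz_e Ec Ev]]] [f [f' [nz_f Fc Fv]]].
have [p [q [nz_p Epq]]] := oreA e nz_f.
exists (p * e), (p * e' + q * f'); split; first exact: mulf_neq0.
  by rewrite mulrDr mulrDl -mulrA Ec Epq -!mulrA Fc.
by rewrite mulrDr mulrDl -mulrA Ev Epq -!mulrA Fv.
Qed.

Lemma lfrac_ex x a : valid x -> exists c v, c != 0 /\ lfrac x (c * a) v.
Proof.
move=> vx; have [p [q [nz_p Epq]]] := oreA a vx.
by exists p, (q * x.2); rewrite Epq; split=> //; apply/lfracZ/lfrac_self.
Qed.

Lemma lfrac_common x y : valid x -> valid y ->
  exists c v w, [/\ c != 0, lfrac x c v & lfrac y c w].
Proof.
move=> vx vy; have [c [w [nz_c yw]]] := lfrac_ex x.1 vy.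
exists (c * x.1), (c * x.2), w; split; first exact: mulf_neq0.
  exact/lfracZ/lfrac_self.
exact: yw.
Qed.

Definition lfrac_eqv x y := lfrac x y.1 y.2.

Lemma lfrac_eqvP x y c v : valid x -> valid y -> c != 0 ->
  lfrac x c v -> lfrac y c v -> lfrac_eqv x y.
Proof.
move=> vx vy nz_c xcv ycv; apply/(lfrac_change _ _ vx nz_c xcv).
exact/(lfrac_change _ _ vy nz_c ycv)/lfrac_self.
Qed.

Lemma lfrac_eqvE x y c v : valid x -> valid y -> lfrac_eqv x y ->
  lfrac y c v -> lfrac x c v.
Proof.
by move=> vx vy xy; rewrite (lfrac_change _ _ vx vy xy) -surjective_pairing.
Qed.

Lemma lfrac_eqv_sym x y : valid x -> valid y -> lfrac_eqv x y -> lfrac_eqv y x.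
Proof. move=> vx vy xy; exact: lfrac_eqvP (lfrac_self y) xy. Qed.

Lemma lfrac_eqv_trans x y z : valid x -> valid y -> valid z ->
  lfrac_eqv x y -> lfrac_eqv y z -> lfrac_eqv x z.
Proof. by move=> vx vy vz xy; apply: lfrac_eqvE. Qed.

(** Validity stands below the existential, so that choice gives an operation on all pairs. *)
Lemma add_ex x y : exists s : A * A, valid x -> valid y ->
  valid s /\ exists v w, [/\ lfrac x s.1 v, lfrac y s.1 w & s.2 = v + w].
Proof.
have [vx|] := boolP (valid x); last by exists 0.
have [vy|] := boolP (valid y); last by exists 0.
have [c [v [w [nz_c xv yw]]]] := lfrac_common vx vy.
by exists (c, v + w) => _ _; split=> //; exists v, w.
Qed.

Lemma mul_ex x y : exists s : A * A, valid x -> valid y ->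
  valid s /\ exists2 v, lfrac x s.1 v & lfrac y v s.2.
Proof.
have [vx|] := boolP (valid x); last by exists 0.
have [vy|] := boolP (valid y); last by exists 0.
have [c [w [nz_c yw]]] := lfrac_ex x.2 vy.
exists (c * x.1, w) => _ _; split; first exact: mulf_neq0.
by exists (c * x.2) => //; apply/lfracZ/lfrac_self.
Qed.

Definition fadd x y := sval (cid (add_ex x y)).
Definition fmul x y := sval (cid (mul_ex x y)).
Definition fopp x := (x.1, - x.2).

Lemma fadd_valid x y : valid x -> valid y -> valid (fadd x y).
Proof. by move=> vx vy; rewrite /fadd; case: cid => s /= /(_ vx vy)[]. Qed.

Lemma fmul_valid x y : valid x -> valid y -> valid (fmul x y).
Proof. by move=> vx vy; rewrite /fmul; case: cid => s /= /(_ vx vy)[]. Qed.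

(** The denominator picked by choice is irrelevant: the sum acts as expected at every [c] where both
    summands have a value. *)
Lemma faddP x y c v w : valid x -> valid y ->
  lfrac x c v -> lfrac y c w -> lfrac (fadd x y) c (v + w).
Proof.
move=> vx vy; rewrite /fadd; case: cid => -[c0 s0] /= /(_ vx vy).
case=> nz_c0 [v0 [w0 [xv0 yw0 ->]]] xv yw.
have [p [q [nz_p Epq]]] := oreA c nz_c0; exists p, q; split=> //=.
rewrite !mulrDr; congr (_ + _).
  by apply: (lfrac_fun vx (lfracZ p xv)); rewrite Epq; exact: lfracZ.
by apply: (lfrac_fun vy (lfracZ p yw)); rewrite Epq; exact: lfracZ.
Qed.

Lemma fmulP x y c v w : valid x -> valid y ->
  lfrac x c v -> lfrac y v w -> lfrac (fmul x y) c w.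
Proof.
move=> vx vy; rewrite /fmul; case: cid => -[c0 w0] /= /(_ vx vy).
case=> nz_c0 [v0 xv0 yw0] xv yw.
have [p [q [nz_p Epq]]] := oreA c nz_c0; exists p, q; split=> //=.
apply: (lfrac_fun vy (lfracZ p yw)).
have -> : p * v = q * v0; last exact: lfracZ.
by apply: (lfrac_fun vx (lfracZ p xv)); rewrite Epq; exact: lfracZ.
Qed.

Lemma foppP x c v : lfrac x c v -> lfrac (fopp x) c (- v).
Proof. by case=> e [e' [nz_e Ec Ev]]; exists e, e'; rewrite !mulrN Ev. Qed.

Lemma lfrac0 c : lfrac (1, 0) c 0.
Proof. by exists 1, c; rewrite oner_eq0 mul1r mulr1 !mulr0. Qed.

Lemma lfrac_ring a c : lfrac (1, a) c (c * a).
Proof. by exists 1, c; rewrite oner_eq0 !mul1r mulr1. Qed.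

Lemma lfrac1 c : lfrac (1, 1) c c.
Proof. by have := lfrac_ring 1 c; rewrite mulr1. Qed.

Lemma valid_ring a : valid ((1, a) : A * A).
Proof. exact: oner_neq0. Qed.

Lemma lfrac_common3 x y z : valid x -> valid y -> valid z ->
  exists c v w t, [/\ c != 0, lfrac x c v, lfrac y c w & lfrac z c t].
Proof.
move=> vx vy vz; have [c [v [w [nz_c xv yw]]]] := lfrac_common vx vy.
have [d [t [nz_d zt]]] := lfrac_ex c vz.
exists (d * c), (d * v), (d * w), t; split; first exact: mulf_neq0.
- exact: lfracZ.
- exact: lfracZ.
- exact: zt.
Qed.

Local Hint Resolve valid_ring fadd_valid fmul_valid : core.

(** For each law, a nonzero denominator is found at which both sides have a value, and the two
    values are compared in [A]. *)
Definition ore_setoid : divSetoid.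
Proof.
refine (@DivSetoid (A * A)%type (fun x : A * A => valid x) lfrac_eqv
  (1, 0) (1, 1)
  fadd fopp fmul _ lfrac_eqv_sym lfrac_eqv_trans _ _ fadd_valid _
  fmul_valid
  _ _ _ _ _ _ _ _ _ _ _ _ _ _) => //.
- by move=> x _; exact: lfrac_self.
- move=> x x' y y' vx vx' vy vy' xx yy.
  have [c [v [w [nz_c xv yw]]]] := lfrac_common vx' vy'.
  apply: (@lfrac_eqvP _ _ c (v + w)); auto; apply: faddP => //.
    exact: lfrac_eqvE xv.
  exact: lfrac_eqvE yw.
- move=> x x' vx vx' xx; apply: (@lfrac_eqvP _ _ x'.1 (- x'.2)) => //.
    exact: foppP.
  exact/foppP/lfrac_self.
- move=> x x' y y' vx vx' vy vy' xx yy.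
  have [c [w [nz_c yw]]] := lfrac_ex x'.2 vy'.
  have xc : lfrac x' (c * x'.1) (c * x'.2) by apply/lfracZ/lfrac_self.
  apply: (@lfrac_eqvP _ _ (c * x'.1) w); auto.
  + apply: (fmulP vx vy); first exact: lfrac_eqvE xc.
    exact: lfrac_eqvE yw.
  + exact: fmulP xc yw.
- move=> x y z vx vy vz.
  have [c [v [w [t [nz_c xv yw zt]]]]] := lfrac_common3 vx vy vz.
  apply: (@lfrac_eqvP _ _ c (v + (w + t))); auto; last rewrite addrA;
    by auto 6 using faddP.
- move=> x y vx vy; have [c [v [w [nz_c xv yw]]]] := lfrac_common vx vy.
  by apply: (@lfrac_eqvP _ _ c (v + w)); auto using faddP; rewrite addrC;
    auto using faddP.
- move=> x vx; apply: (@lfrac_eqvP _ _ x.1 x.2); auto using lfrac_self.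
  by rewrite -[x.2]add0r; apply: faddP; auto using lfrac_self, lfrac0.
- move=> x vx; apply: (@lfrac_eqvP _ _ x.1 0); auto using lfrac0.
  by rewrite -(addNr x.2); apply: faddP; auto using foppP, lfrac_self.
- move=> x y z vx vy vz.
  (* First [d] makes [z] defined on [d * y.2]; then [p] makes the value of [x] a left multiple of
     [d * y.1], so that [x], [y], [z] can be applied in turn. *)
  have [d [t [nz_d zt]]] := lfrac_ex y.2 vz.
  have [p [q [nz_p Epq]]] := oreA x.2 (mulf_neq0 nz_d vy).
  have xc : lfrac x (p * x.1) (q * (d * y.1)).
    by rewrite -Epq; apply/lfracZ/lfrac_self.
  have yw := lfracZ q (lfracZ d (lfrac_self y)); have zt' := lfracZ q zt.
  apply: (@lfrac_eqvP _ _ (p * x.1) (q * t)); auto.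
  + by apply: fmulP xc _; auto; apply: fmulP yw zt'.
  + by apply: fmulP _ zt'; auto; apply: fmulP xc yw.
- move=> x vx; apply: (@lfrac_eqvP _ _ x.1 x.2); auto using lfrac_self.
  by apply: fmulP; auto using lfrac1, lfrac_self.
- move=> x vx; apply: (@lfrac_eqvP _ _ x.1 x.2); auto using lfrac_self.
  by apply: fmulP; auto using lfrac1, lfrac_self.
- move=> x y z vx vy vz.
  have [c [v [w [nz_c xv yw]]]] := lfrac_common vx vy.
  have [d [t [nz_d zt]]] := lfrac_ex v vz.
  have [d' [t' [nz_d' zt']]] := lfrac_ex (d * w) vz.
  have zt'' := lfracZ d' zt.
  have xv' := lfracZ d' (lfracZ d xv); have yw' := lfracZ d' (lfracZ d yw).
  apply: (@lfrac_eqvP _ _ (d' * (d * c)) (d' * t + t')); auto.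
  + apply: (fmulP (fadd_valid vx vy) vz); first exact: faddP xv' yw'.
    exact: lfracD.
  + by apply: faddP; auto; [apply: fmulP xv' zt''|apply: fmulP yw' zt'].
- move=> x y z vx vy vz.
  have [c [v [w [nz_c yv zw]]]] := lfrac_common vy vz.
  have [p [q [nz_p Epq]]] := oreA x.2 nz_c.
  have xc : lfrac x (p * x.1) (q * c) by rewrite -Epq; apply/lfracZ/lfrac_self.
  have yv' := lfracZ q yv; have zw' := lfracZ q zw.
  apply: (@lfrac_eqvP _ _ (p * x.1) (q * v + q * w)); auto.
  + by apply: fmulP xc _; auto; apply: faddP.
  + by apply: faddP; auto; [apply: fmulP xc yv'|apply: fmulP xc zw'].
- move=> /(lfrac_fun (valid_ring 1) (lfrac1 1)) /eqP.
  by rewrite oner_eq0.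
- move=> x vx nx0; have nz_x2 : x.2 != 0.
    apply/eqP => x20; apply: nx0.
    have [p [q [nz_p Epq]]] := oreA 1 vx.
    by exists p, q; rewrite /= x20 !mulr0.
  exists (x.2, x.1); split=> //.
    apply: (@lfrac_eqvP _ _ x.1 x.1); auto using lfrac1.
    by apply: fmulP (lfrac_self x) _; auto; apply: (lfrac_self (x.2, x.1)).
  apply: (@lfrac_eqvP _ _ x.2 x.2); auto using lfrac1.
  by apply: fmulP (lfrac_self (x.2, x.1)) _; auto; apply: (lfrac_self x).
Defined.

End OreFractions.

Lemma divring_mulf_eq0 (F : divRingType) (a b : F) :
  a * b = 0 -> a = 0 \/ b = 0.
Proof.
have [->|nz_a] := eqVneq a 0; first by left.
move/(congr1 ( *%R a^-1)); rewrite mulKr ?mulr0; last exact: divring_axiom.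
by right.
Qed.

Lemma divring_mulf_neq0 (F : divRingType) (a b : F) :
  a != 0 -> b != 0 -> a * b != 0.
Proof. by move=> /eqP na /eqP nb; apply/eqP => /divring_mulf_eq0[]. Qed.

Definition central (R : nzRingType) (s : R) := forall a, s * a = a * s.

(** The last clause, that all elements are left fractions, serves to transfer centrality from [A] to
    [D]. *)
Lemma ore_field (A : nzRingType)
    (domA : forall a b : A, a * b = 0 -> a = 0 \/ b = 0)
    (oreA : forall a b : A, b != 0 -> exists c d, c != 0 /\ c * a = d * b) :
  exists (D : divRingType) (i : {rmorphism A -> D}),
    injective i /\ forall x, exists a b, b != 0 /\ i b * x = i a.
Proof.
pose X := ore_setoid domA oreA; pose D : divRingType := squot X.
pose i (a : A) : D := spi ((1 : A, a) : X).
have vi (a : A) : valid ((1 : A, a) : X) by exact: oner_neq0.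
have fracP (x y : X) c v : valid x -> valid y -> c != 0 ->
    lfrac x c v -> lfrac y c v -> spi x = spi y.
  by move=> vx vy nz_c xc yc; apply/spiP => //; exact: lfrac_eqvP xc yc.
have ri a := @lfrac_ring A a 1; rewrite /= in ri.
have iB : zmod_morphism i.
  move=> a b; apply/eqP; rewrite eq_sym subr_eq; apply/eqP.
  rewrite /i -spiD //; apply: (@fracP _ _ 1 a) => //.
  - exact: validD.
  - exact: oner_neq0.
  - by have := ri a; rewrite mul1r.
  have := @faddP A domA oreA _ _ 1 (a - b) b (vi _) (vi b).
  rewrite subrK; apply; first by have := ri (a - b); rewrite mul1r.
  by have := ri b; rewrite mul1r.
have iM : monoid_morphism i.
  split=> // a b; rewrite /i -spiM //; apply: (@fracP _ _ 1 (a * b)) => //.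
  - exact: validM.
  - exact: oner_neq0.
  - by have := ri (a * b); rewrite mul1r.
  apply: (@fmulP A domA oreA _ _ 1 a (a * b) (vi _) (vi b)).
    by have := ri a; rewrite mul1r.
  exact: lfrac_ring.
pose iZ := GRing.isZmodMorphism.Build A D i iB.
pose iR := GRing.isMonoidMorphism.Build A D i iM.
pose f : {rmorphism A -> D} := HB.pack i iZ iR.
exists D, f; split=> [a b|]; last first.
  elim/spi_ind => -[b a] vx; exists a, b; split=> //.
  rewrite /= /i -spiM //; apply: (@fracP _ _ 1 a) => //.
  - exact: validM.
  - exact: oner_neq0.
  - apply: (@fmulP A domA oreA (1, b) (b, a) 1 b a (vi _) vx).
      by have := ri b; rewrite mul1r.
    exact: (lfrac_self (b, a)).
  by have := ri a; rewrite mul1r.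
move=> /= /spiP -/(_ (vi a) (vi b)) ab.
have := ri a; rewrite mul1r => ra.
by rewrite (lfrac_fun domA oreA (vi a) ra ab).
Qed.

(** * Polynomials in a central variable over a division ring *)

Section PolynomialsOverDivisionRing.

Variable D : divRingType.
Implicit Types p q : {poly D}.

Lemma polydiv_domain p q : p * q = 0 -> p = 0 \/ q = 0.
Proof.
have [->|nz_p] := eqVneq p 0; first by left.
have [->|nz_q] := eqVneq q 0; first by right.
have nz_pq : lead_coef p * lead_coef q != 0.
  by apply: divring_mulf_neq0; rewrite lead_coef_eq0.
move/eqP; rewrite -lead_coef_eq0 lead_coef_proper_mul //.
by rewrite (negPf nz_pq).
Qed.

Lemma polydiv_division p q : q != 0 ->
  exists a r, p = a * q + r /\ (size r < size q)%N.
Proof.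
move=> nz_q; set c := lead_coef q.
have nz_c : c != 0 by rewrite lead_coef_eq0.
have Uc : c \is a GRing.unit by exact: divring_axiom.
have nz_ci : c^-1 != 0 by apply: contraTneq Uc => E; rewrite -unitrV E unitr0.
pose q1 := c^-1%:P * q.
have nz_cq : lead_coef c^-1%:P * lead_coef q != 0.
  by rewrite lead_coefC divring_mulf_neq0.
have mon_q1 : q1 \is monic.
  by apply/monicP; rewrite lead_coef_proper_mul // lead_coefC mulVr.
have sz_q1 : size q1 = size q.
  by rewrite size_proper_mul // size_polyC nz_ci.
exists (Pdiv.Ring.rdivp p q1 * c^-1%:P), (Pdiv.Ring.rmodp p q1).
rewrite -mulrA -[_%:P * q]/q1 -Pdiv.RingMonic.rdivp_eq //; split=> //.
by rewrite -sz_q1 Pdiv.Ring.ltn_rmodp monic_neq0.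
Qed.

(** Euclidean descent: from p = a q + r and c q = e r one gets e p = (e a + c) q, and e = 0 would
    force c q = 0. *)
Lemma polydiv_ore p q : q != 0 ->
  exists a b, a != 0 /\ a * p = b * q.
Proof.
have [n] := ubnP (size q); elim: n => // n IHn in p q * => le_q nz_q.
have [a [r [Ep lt_r]]] := polydiv_division p nz_q.
have [r0|nz_r] := eqVneq r 0.
  by exists 1, a; rewrite oner_neq0 mul1r Ep r0 addr0.
have [c [e [nz_c Ecr]]] := IHn q r (leq_trans lt_r le_q) nz_r.
exists e, (e * a + c); rewrite Ep mulrDr mulrDl mulrA Ecr; split=> //.
apply: contraNneq nz_c => e0; move: Ecr; rewrite e0 mul0r.
by case/polydiv_domain => [->//|q0]; rewrite q0 eqxx in nz_q.
Qed.

Lemma central_comm_poly p s : central s -> comm_poly p s.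
Proof. by move=> Cs; rewrite /comm_poly Cs. Qed.

(** Evaluation over a noncommutative ring is multiplicative at central points, which is why lines
    are given central parameters. *)
Lemma hornerM_central p q s : central s -> (p * q).[s] = p.[s] * q.[s].
Proof. by move=> Cs; rewrite hornerM_comm //; exact: central_comm_poly. Qed.

(** Each central root splits off a linear factor and lowers the degree, so the central roots form a
    finite list. *)
Lemma central_nonroots p : p != 0 ->
  exists l : seq D, forall s, central s -> s \notin l -> p.[s] != 0.
Proof.
have [n] := ubnP (size p); elim: n => // n IHn in p * => le_p nz_p.
have [[a [Ca /factor_theorem[q Eq]]]|norts] :=
    pselect (exists a, central a /\ root p a); last first.
  by exists [::] => s Cs _; apply/negP => ps; apply: norts; exists s.
have nz_q : q != 0 by apply: contraNneq nz_p => q0; rewrite Eq q0 mul0r.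
have [|l lP] := IHn q _ nz_q.
  by move: le_p; rewrite Eq size_Mmonic ?monicXsubC // size_XsubC addn2.
exists (a :: l) => s Cs; rewrite inE negb_or => /andP[nsa sl].
rewrite Eq hornerM_central // hornerXsubC divring_mulf_neq0 ?lP //.
by rewrite subr_eq0.
Qed.

End PolynomialsOverDivisionRing.

(* The division ring of fractions of F[z], with z central. *)
Lemma infinite_center_extension (F : divRingType) :
  exists (D : divRingType) (h : {rmorphism F -> D}),
    forall l : seq D, exists2 s, central s & s \notin l.
Proof.
have [D [i [inj_i fracD]]] :=
  ore_field (@polydiv_domain F) (@polydiv_ore F).
exists D, (i \o polyC : {rmorphism F -> D}) => l.
have central_Xn n : central (i 'X^n).
  move=> x; have [a [b [nz_b Ex]]] := fracD x.
  have Ub : i b \is a GRing.unit.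
    by apply: divring_axiom; rewrite -(rmorph0 i) (inj_eq inj_i).
  apply: (mulrI Ub); rewrite mulrA -rmorphM commr_polyXn rmorphM.
  by rewrite -mulrA Ex mulrA Ex -!rmorphM commr_polyXn.
have [[n nl]|all_l] := pselect (exists n, i 'X^n \notin l).
  by exists (i 'X^n).
(* The powers of the variable are pairwise distinct, so a finite list cannot contain them all. *)
have : uniq [seq i 'X^n | n <- iota 0 (size l).+1].
  rewrite map_inj_uniq ?iota_uniq // => m n.
  move=> /inj_i/(congr1 (fun p : {poly F} => size p)).
  by rewrite !size_polyXn => -[].
move/uniq_leq_size => /(_ l); rewrite size_map size_iota ltnn => H.
suff: false by []; apply: H => _ /mapP[n _ ->].
by apply/negPn/negP => nl; apply: all_l; exists n.
Qed.

(** * Germs of rational functions *)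

(** Ore condition localized at 0. If a(0) = 0, then b(0) q(0) = 0 forces b(0) = 0, and the central
    factor ['X] cancels from [a] and [b]. This keeps the denominators of sums and products nonzero
    at the base point. *)
Lemma polydiv_ore_at0 (D : divRingType) (p q : {poly D}) : q.[0] != 0 ->
  exists a b, a.[0] != 0 /\ a * p = b * q.
Proof.
move=> nz_q0; have C0 : central (0 : D) by move=> a; rewrite mul0r mulr0.
have nz_q : q != 0 by apply: contraNneq nz_q0 => ->; rewrite horner0.
have [a [b [nz_a Eab]]] := polydiv_ore p nz_q.
have [n] := ubnP (size a); elim: n => // n IHn in a b nz_a Eab * => le_a.
have [a0|nz_a0] := eqVneq a.[0] 0; last by exists a, b.
have divX (c : {poly D}) : c.[0] = 0 -> exists d, c = d * 'X.
  move=> c0; have /factor_theorem[d ->] : root c 0 by apply/eqP.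
  by exists d; rewrite subr0.
have [a' Ea] := divX _ a0.
have [b' Eb] : exists b', b = b' * 'X.
  apply: divX; have := congr1 (fun c : {poly D} => c.[0]) Eab.
  rewrite !hornerM_central // a0 mul0r => /esym/divring_mulf_eq0[//|q0].
  by rewrite q0 eqxx in nz_q0.
apply: (IHn a' b').
- by apply: contraNneq nz_a => a'0; rewrite Ea a'0 mul0r.
- move/eqP: Eab; rewrite Ea Eb -!mulrA -!commr_polyX !mulrA -subr_eq0 -mulrBl.
  move=> /eqP/polydiv_domain[/eqP|/eqP]; last by rewrite polyX_eq0.
  by rewrite subr_eq0 => /eqP.
- have nz_a' : a' != 0 by apply: contraNneq nz_a => a'0; rewrite Ea a'0 mul0r.
  by move: le_a; rewrite Ea size_mulX.
Qed.

Section GenericFunctions.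

Variables (D : divRingType) (I : Type).

Definition line (w v : I -> D) (s : D) : I -> D := fun i => w i + s * v i.

Lemma line0 w v : line w v 0 = w.
Proof. by apply: funext => i; rewrite /line mul0r addr0. Qed.

Variable Om : set (I -> D).
Hypothesis Om_neq0 : exists w, Om w.
Hypothesis Om_line : forall w v s, Om w -> Om v -> central s -> Om (line w v s).
Hypothesis infinite_center :
  forall l : seq D, exists2 s, central s & s \notin l.

Let C0 : central (0 : D). Proof. by move=> a; rewrite mul0r mulr0. Qed.
Let C1 : central (1 : D). Proof. by move=> a; rewrite mul1r mulr1. Qed.

Let centralB (a b : D) : central a -> central b -> central (a - b).
Proof. by move=> Ca Cb c; rewrite mulrBl mulrBr Ca Cb. Qed.

(* "Zariski open": a line through a point of O meets the complement of O in
   finitely many points. *)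
Definition generic (O : set (I -> D)) :=
  [/\ forall w, O w -> Om w, exists w, O w &
      forall w v, O w -> Om v ->
        exists l : seq D, forall s, central s -> s \notin l -> O (line w v s)].

Lemma generic_setT : generic Om.
Proof. by split=> // w v Ow Ov; exists [::] => s Cs _; exact: Om_line. Qed.

(** Join a point of [O] to a point of [O']. The line leaves either set for finitely many central
    parameters only, and the center is infinite; parameter [s] seen from one end is [1 - s] seen
    from the other. *)
Lemma genericI O O' : generic O -> generic O' -> generic (O `&` O').
Proof.
move=> [OOm [w Ow] Ogen] [O'Om [w' O'w'] O'gen]; split.
- by move=> x [/OOm].
- have Omd x y : Om x -> Om y -> Om (fun i => x i - y i).
    move=> Omx Omy; suff -> : (fun i => x i - y i) = line x y (0 - 1).
      by apply: Om_line; auto.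
    by apply: funext => i; rewrite /line sub0r mulN1r.
  have [l lP] := Ogen w _ Ow (Omd _ _ (O'Om _ O'w') (OOm _ Ow)).
  have [l' l'P] := O'gen w' _ O'w' (Omd _ _ (OOm _ Ow) (O'Om _ O'w')).
  have [s Cs] := infinite_center (l ++ [seq 1 - s | s <- l']).
  rewrite mem_cat negb_or => /andP[sl sl'].
  exists (line w (fun i => w' i - w i) s); split; first exact: lP.
  have -> : line w (fun i => w' i - w i) s =
      line w' (fun i => w i - w' i) (1 - s).
    apply: funext => i; rewrite /line mulrBl mul1r addrA subrKC.
    by rewrite -mulrN opprB.
  apply: l'P; first exact: centralB.
  apply: contra sl' => sl'; apply/mapP; exists (1 - s) => //.
  by rewrite opprB subrKC.
- move=> x v [Ox O'x] Omv.
  have [l lP] := Ogen x v Ox Omv; have [l' l'P] := O'gen x v O'x Omv.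
  exists (l ++ l') => s Cs; rewrite mem_cat negb_or => /andP[sl sl'].
  by split; [exact: lP | exact: l'P].
Qed.

(* f restricted to the line through w in direction v is, near w, a left
   fraction q^-1 p of polynomials. *)
Definition regular_at (O : set (I -> D)) (f : (I -> D) -> D) w v :=
  exists p q : {poly D}, q.[0] != 0 /\
    forall s, central s -> O (line w v s) -> q.[s] * f (line w v s) = p.[s].

Definition regular_on (O : set (I -> D)) f :=
  forall w v, O w -> Om v -> regular_at O f w v.

Definition rational f := exists2 O, generic O & regular_on O f.

Definition generic_eq (f g : (I -> D) -> D) :=
  exists2 O, generic O & forall w, O w -> f w = g w.

Lemma regular_sub O O' f : (O `<=` O')%classic ->
  regular_on O' f -> regular_on O f.
Proof.
move=> OO' f_reg w v Ow Omv; have [p [q [q0 E]]] := f_reg w v (OO' _ Ow) Omv.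
by exists p, q; split=> // s Cs Os; apply: E => //; exact: OO'.
Qed.

Lemma rational2 f g : rational f -> rational g ->
  exists O, [/\ generic O, regular_on O f & regular_on O g].
Proof.
move=> [O genO fO] [O' genO' gO']; exists (O `&` O')%classic.
split; first exact: genericI.
  by apply: regular_sub fO => w [].
by apply: regular_sub gO' => w [].
Qed.

Lemma regularD O f g : regular_on O f -> regular_on O g ->
  regular_on O (fun w => f w + g w).
Proof.
move=> fO gO w v Ow Omv; have [p [q [q0 E]]] := fO w v Ow Omv.
have [p' [q' [q'0 E']]] := gO w v Ow Omv.
have [a [b [a0 Eab]]] := polydiv_ore_at0 q q'0.
exists (a * p + b * p'), (a * q); split.
  by rewrite hornerM_central // divring_mulf_neq0.
move=> s Cs Os /=; rewrite mulrDr {2}Eab hornerD !hornerM_central //.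
by rewrite -(mulrA a.[s]) -(mulrA b.[s]) E // E'.
Qed.

(** With a p = b q', the product of q^-1 p and q'^-1 p' is (a q)^-1 b p'. *)
Lemma regularM O f g : regular_on O f -> regular_on O g ->
  regular_on O (fun w => f w * g w).
Proof.
move=> fO gO w v Ow Omv; have [p [q [q0 E]]] := fO w v Ow Omv.
have [p' [q' [q'0 E']]] := gO w v Ow Omv.
have [a [b [a0 Eab]]] := polydiv_ore_at0 p q'0.
exists (b * p'), (a * q); split.
  by rewrite hornerM_central // divring_mulf_neq0.
move=> s Cs Os /=; rewrite !hornerM_central // -E' // [LHS]mulrA.
rewrite -[_ * f _]mulrA E //.
by rewrite -hornerM_central // Eab hornerM_central // mulrA.
Qed.

Lemma rationalD f g : rational f -> rational g -> rational (fun w => f w + g w).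
Proof.
move=> rf rg; have [O [genO fO gO]] := rational2 rf rg.
by exists O => //; exact: regularD.
Qed.

Lemma rationalM f g : rational f -> rational g -> rational (fun w => f w * g w).
Proof.
move=> rf rg; have [O [genO fO gO]] := rational2 rf rg.
by exists O => //; exact: regularM.
Qed.

Lemma rational_const a : rational (fun=> a).
Proof.
exists Om; first exact: generic_setT.
move=> w v _ _; exists a%:P, 1; rewrite hornerC oner_neq0; split=> // s _ _.
by rewrite !hornerC mul1r.
Qed.

Lemma regular_coord i : regular_on Om (fun w => w i).
Proof.
move=> w v _ _; exists ((w i)%:P + (v i)%:P * 'X), 1.
rewrite hornerC oner_neq0; split=> // s Cs _.
by rewrite hornerD hornerMX !hornerC mul1r /line Cs.
Qed.

Lemma rational_coord i : rational (fun w => w i).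
Proof. by exists Om; [exact: generic_setT | exact: regular_coord]. Qed.

Lemma rationalN f : rational f -> rational (fun w => - f w).
Proof.
move=> rf; have := rationalM (rational_const (- 1)) rf.
by congr rational; apply: funext => w; rewrite mulN1r.
Qed.

(** On a line through a point where [f] is nonzero, the numerator is a nonzero polynomial and has
    finitely many central roots. *)
Lemma generic_support f O : generic O -> regular_on O f ->
  (exists2 w, O w & f w != 0) -> generic (O `&` [set w | f w != 0]).
Proof.
move=> [OOm _ Ogen] fO [w0 Ow0 fw0]; split.
- by move=> w [/OOm].
- by exists w0.
- move=> w v [Ow fw] Omv; have [p [q [q0 E]]] := fO w v Ow Omv.
  have nz_p : p != 0.
    apply: contra_neq (divring_mulf_neq0 q0 fw) => p0.
    by have := E 0 C0; rewrite line0 p0 horner0; apply.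
  have [l lP] := central_nonroots nz_p; have [l' l'P] := Ogen w v Ow Omv.
  exists (l ++ l') => s Cs; rewrite mem_cat negb_or => /andP[sl sl'].
  have Os := l'P s Cs sl'; split=> //=.
  apply: contra_neq (lP s Cs sl) => fs0.
  by rewrite -E // fs0 mulr0.
Qed.

Lemma coord_neq0 i : (exists2 w, Om w & w i != 0) ->
  ~ generic_eq (fun w => w i) (fun=> 0).
Proof.
move=> /(generic_support generic_setT (regular_coord i)) gen_i [O genO wi0].
have [_ [w [[_ /eqP wi] Ow]] _] := genericI gen_i genO.
exact: wi (wi0 w Ow).
Qed.

(** The pointwise inverse works: [f] is nonzero on a generic set, and there numerator and
    denominator can be exchanged. *)
Lemma rationalV f : rational f -> ~ generic_eq f (fun=> 0) ->
  exists g, [/\ rational g, generic_eq (fun w => f w * g w) (fun=> 1)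
              & generic_eq (fun w => g w * f w) (fun=> 1)].
Proof.
move=> [O genO fO] nf0; exists (fun w => (f w)^-1).
have /(generic_support genO fO) genO' : exists2 w, O w & f w != 0.
  have [//|nof] := pselect (exists2 w, O w & f w != 0).
  case: nf0; exists O => // w Ow; apply/eqP/negPn/negP => fw.
  by apply: nof; exists w.
have Uf w : f w != 0 -> f w \is a GRing.unit by exact: divring_axiom.
split.
- exists (O `&` [set w | f w != 0])%classic => // w v [Ow fw] Omv.
  have [p [q [q0 E]]] := fO w v Ow Omv; exists q, p; split.
    by have := E 0 C0; rewrite line0 => <- //; exact: divring_mulf_neq0.
  by move=> s Cs [Os fs]; rewrite -E // mulrK // Uf.
- by exists (O `&` [set w | f w != 0])%classic => // w [_ /Uf/mulrV].
- by exists (O `&` [set w | f w != 0])%classic => // w [_ /Uf/mulVr].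
Qed.

Lemma generic_eq_ext f g : (forall w, f w = g w) -> generic_eq f g.
Proof. by move=> fg; exists Om; [exact: generic_setT | move=> w _]. Qed.

Lemma generic_eq2 f g f' g' (op : D -> D -> D) :
  generic_eq f f' -> generic_eq g g' ->
  generic_eq (fun w => op (f w) (g w)) (fun w => op (f' w) (g' w)).
Proof.
move=> [O genO ff'] [O' genO' gg']; exists (O `&` O')%classic.
  exact: genericI.
by move=> w [Ow O'w]; rewrite ff' // gg'.
Qed.

(** Operations are pointwise, so the ring laws hold at every point; genericity is needed for
    equality of germs and for inverses. *)
Definition rational_setoid : divSetoid.
Proof.
refine (@DivSetoid ((I -> D) -> D) rational generic_eq (fun=> 0) (fun=> 1)
  (fun f g w => f w + g w) (fun f w => - f w) (fun f g w => f w * g w)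
  _ _ _ (rational_const 0) (rational_const 1) rationalD rationalN rationalM
  _ _ _ _ _ _ _ _ _ _ _ _ _ rationalV).
- by move=> f _; exact: generic_eq_ext.
- by move=> f g _ _ [O genO E]; exists O => // w Ow; rewrite E.
- move=> f g h _ _ _ [O genO E] [O' genO' E'].
  exists (O `&` O')%classic; first exact: genericI.
  by move=> w [Ow O'w]; rewrite E // E'.
- by move=> f f' g g' _ _ _ _; exact: generic_eq2.
- by move=> f f' _ _ [O genO E]; exists O => // w Ow; rewrite E.
- by move=> f f' g g' _ _ _ _; exact: generic_eq2.
- by move=> f g h _ _ _; apply: generic_eq_ext => w; rewrite addrA.
- by move=> f g _ _; apply: generic_eq_ext => w; rewrite addrC.
- by move=> f _; apply: generic_eq_ext => w; rewrite add0r.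
- by move=> f _; apply: generic_eq_ext => w; rewrite addNr.
- by move=> f g h _ _ _; apply: generic_eq_ext => w; rewrite mulrA.
- by move=> f _; apply: generic_eq_ext => w; rewrite mul1r.
- by move=> f _; apply: generic_eq_ext => w; rewrite mulr1.
- by move=> f g h _ _ _; apply: generic_eq_ext => w; rewrite mulrDl.
- by move=> f g h _ _ _; apply: generic_eq_ext => w; rewrite mulrDr.
- case=> O [_ [w Ow] _] /(_ w Ow) /eqP; rewrite oner_eq0; by [].
Defined.

Lemma rational_field :
  exists (E : divRingType) (pi : ((I -> D) -> D) -> E),
    [/\ forall e, exists2 f, rational f & pi f = e,
        forall f g, rational f -> rational g -> pi f = pi g <-> generic_eq f g,
        pi (fun=> 1) = 1,
        forall f g, rational f -> rational g ->
          pi (fun w => f w + g w) = pi f + pi g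
      & forall f g, rational f -> rational g ->
          pi (fun w => f w * g w) = pi f * pi g].
Proof.
exists (squot rational_setoid), (@spi rational_setoid); split.
- move=> e; exists (srep e); last exact: srepK.
  exact: (@srep_valid rational_setoid e).
- exact: (@spiP rational_setoid).
- by [].
- exact: (@spiD rational_setoid).
- exact: (@spiM rational_setoid).
Qed.

Section Substitution.

Variable T : (I -> D) -> (I -> D).
Hypothesis T_Om : forall w, Om w -> Om (T w).
Hypothesis T_line : forall w v s, central s ->
  T (line w v s) = line (T w) (T v) s.
Hypothesis T_surj : forall w, Om w -> exists2 w', Om w' & T w' = w.

(** Surjectivity of [T] provides a point of the preimage, and [T] carries lines to lines with the
    same parameter. *)
Lemma generic_preimage O : generic O -> generic (Om `&` T @^-1` O).
Proof.
move=> [OOm [w Ow] Ogen]; split.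
- by move=> x [].
- by have [w' Omw' Tw'] := T_surj (OOm _ Ow); exists w'; split; rewrite //= Tw'.
- move=> x v [Omx OTx] Omv; have [l lP] := Ogen _ _ OTx (T_Om Omv).
  exists l => s Cs sl; split; first exact: Om_line.
  by rewrite /= T_line //; exact: lP.
Qed.

Lemma rational_comp f : rational f -> rational (f \o T).
Proof.
move=> [O genO fO]; exists (Om `&` T @^-1` O)%classic.
  exact: generic_preimage.
move=> w v [Omw OTw] Omv; have [p [q [q0 E]]] := fO _ _ OTw (T_Om Omv).
exists p, q; split=> // s Cs [_]; rewrite /= T_line // => Os.
exact: E.
Qed.

Lemma generic_eq_comp f g : generic_eq f g -> generic_eq (f \o T) (g \o T).
Proof.
move=> [O genO fg]; exists (Om `&` T @^-1` O)%classic.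
  exact: generic_preimage.
by move=> w [_ /fg].
Qed.

End Substitution.

End GenericFunctions.

(** * Skew polynomials *)

Section SkewEvaluation.

Variables (R : nzRingType) (t : {rmorphism R -> R}).
Implicit Types (f : skewpoly t) (a : R).

(* The remainder of x^i modulo x - a. *)
Fixpoint skew_norm a i : R :=
  if i is j.+1 then iter j t a * skew_norm a j else 1.

Lemma sum_coef_widen (p : {poly R}) (w : nat -> R) m n :
  (size p <= m)%N -> (m <= n)%N ->
  \sum_(i < m) p`_i * w i = \sum_(i < n) p`_i * w i.
Proof.
move=> le_pm le_mn; rewrite (big_ord_widen _ (fun i => p`_i * w i) le_mn).
rewrite [RHS](bigID (fun i : 'I_n => (i < m)%N)) /= [X in _ + X]big1 ?addr0 //.
move=> i; rewrite -leqNgt => le_mi; rewrite nth_default ?mul0r //.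
exact: leq_trans le_mi.
Qed.

Lemma right_evalE f a m : (size f <= m)%N ->
  right_eval f a = \sum_(i < m) f`_i * skew_norm a i.
Proof.
move=> le_fm; have [q Eq] := (right_evalP f a (right_eval f a)).1 erefl.
set c := right_eval f a in Eq *.
(* Telescoping: the coefficients of f = q (x - a) + c are q_(i-1) - q_i t^i(a), with [c] in the role
   of q_(-1). *)
have partial n : \sum_(i < n.+1) f`_i * skew_norm a i =
    c - q`_n * skew_norm a n.+1.
  have coef_f i : f`_i = (if i is j.+1 then q`_j else c) - q`_i * iter i t a.
    rewrite Eq coefD mulrBr coefB coef_skewMX coef_skewMC coefC.
    by case: i => [|i] /=; rewrite ?sub0r ?addr0 // addrC.
  elim: n => [|n IHn]; first by rewrite big_ord1 coef_f /= !mulr1.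
  rewrite big_ord_recr {}IHn /= coef_f mulrBl addrA subrK.
  by rewrite -mulrA.
pose n := maxn m (size q).
rewrite (@sum_coef_widen f _ m n.+1) ?partial //; last first.
  by rewrite ltnW // ltnS leq_maxl.
by rewrite [q`__]nth_default ?mul0r ?subr0 // leq_maxr.
Qed.

End SkewEvaluation.

Section SkewOverDivisionRing.

Variables (F : divRingType) (s : {rmorphism F -> F}).
Implicit Types (p q r f g d : skewpoly s) (a c : F).

Lemma iters_neq0 n a : a != 0 -> iter n s a != 0.
Proof.
move=> nz_a; elim: n => //= n; apply: contra_neq => sa0.
by apply: (@divring_morph_inj _ _ s); rewrite sa0 rmorph0.
Qed.

Lemma coef_skewXnM n p i :
  (skewX s ^+ n * p)`_i = if (i < n)%N then 0 else iter n s p`_(i - n).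
Proof.
rewrite coef_skewM; under eq_bigr => j _ do rewrite coef_skewXn.
case: ltnP => [lt_in|le_ni].
  rewrite big1 // => j _; rewrite (_ : (j == n :> nat) = false) ?mul0r //.
  by apply: ltn_eqF; apply: leq_ltn_trans lt_in; rewrite -ltnS.
rewrite (bigD1 (Ordinal (le_ni : n < i.+1)%N)) //= eqxx mul1r big1 ?addr0 //.
by move=> j; rewrite -val_eqE /= => /negPf->; rewrite mul0r.
Qed.

Lemma size_skewXnM n p : (size (skewX s ^+ n * p)%R <= n + size p)%N.
Proof.
apply/leq_sizeP => i le_i; rewrite coef_skewXnM; case: ltnP => // le_ni.
by rewrite nth_default ?iters0 // leq_subRL.
Qed.

Lemma size_skewCM a p : (size (skewC s a * p)%R <= size p)%N.
Proof.
by apply/leq_sizeP => i le_i; rewrite coef_skewCM nth_default ?mulr0.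
Qed.

(** The top coefficient p_m s^m(q_n) is nonzero, since [s] is injective. *)
Lemma size_skewM p q : p != 0 -> q != 0 ->
  size (p * q) = (size p + size q).-1.
Proof.
move=> nz_p nz_q; apply/eqP; rewrite eqn_leq size_poly /=.
have Ep : size p = (size p).-1.+1 by rewrite polySpred.
have Eq : size q = (size q).-1.+1 by rewrite polySpred.
rewrite {1}Ep {1}Eq addSn addnS /=; set m := (size p).-1; set n := (size q).-1.
suff nz : (p * q)`_(m + n) != 0.
  by rewrite ltnNge; apply: contra nz => le_pq; rewrite nth_default.
have lt_m : (m < (m + n).+1)%N by rewrite ltnS leq_addr.
rewrite coef_skewM (bigD1 (Ordinal lt_m)) //= addKn big1 ?addr0.
  by rewrite divring_mulf_neq0 ?iters_neq0 // -/(lead_coef _) lead_coef_eq0.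
move=> j; rewrite -val_eqE /= => ne_jm; have [lt_jm|le_mj] := ltnP j m.
  rewrite [q`__]nth_default ?iters0 ?mulr0 // Eq -/n.
  by lia.
by rewrite nth_default ?mul0r // Ep -/m ltn_neqAle eq_sym ne_jm.
Qed.

(** The bounds on [r] and [q] in terms of [f] tell later which of the finitely many Sylvester
    equations are available. *)
Lemma skew_division f g : g != 0 -> exists q r,
  [/\ f = q * g + r, (size r < size g)%N, (size r <= size f)%N
    & (size q <= size f - (size g).-1)%N].
Proof.
move=> nz_g; have [n] := ubnP (size f); elim: n => // n IHn in f * => le_f.
have [lt_fg|le_gf] := ltnP (size f) (size g).
  by exists 0, f; rewrite mul0r add0r size_poly0.
have nz_f : f != 0.
  by rewrite -size_poly_gt0 (leq_trans _ le_gf) // size_poly_gt0.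
pose k := (size f - size g)%N; pose b := iter k s (lead_coef g).
have Ub : b \is a GRing.unit.
  by apply/divring_axiom/iters_neq0; rewrite lead_coef_eq0.
pose c := lead_coef f / b.
pose h : skewpoly s := skewC s c * skewX s ^+ k.
have Eg : size g = (size g).-1.+1 by rewrite polySpred.
have Ef : size f = (size f).-1.+1 by rewrite polySpred.
have Ek : (k + (size g).-1)%N = (size f).-1.
  by rewrite /k; lia.
have lt_f1 : (size (f - h * g)%R < size f)%N.
  rewrite Ef ltnS; apply/leq_sizeP => i le_i; rewrite coefB.
  rewrite /h -mulrA coef_skewCM coef_skewXnM ltnNge.
  rewrite (leq_trans _ le_i) /=; last by rewrite -Ek leq_addr.
  move: le_i; rewrite leq_eqVlt => /predU1P[<-|lt_i].
    by rewrite -{2}Ek addKn -/(lead_coef g) -/b /c mulrVK // subrr.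
  rewrite nth_default ?sub0r ?nth_default ?iters0 ?mulr0 ?oppr0 //.
    by rewrite Eg ltn_subRL Ek.
  by rewrite Ef.
have [|q [r [E1 lt_r le_r le_q]]] := IHn (f - h * g).
  exact: leq_trans lt_f1 le_f.
exists (q + h), r; split=> //.
- by rewrite mulrDl addrAC -E1 subrK.
- exact: leq_trans le_r (ltnW lt_f1).
- apply: leq_trans (size_polyD _ _) _; rewrite geq_max; apply/andP; split.
    by apply: leq_trans le_q _; rewrite leq_sub2r // ltnW.
  apply: leq_trans (size_skewCM _ _) _.
  have := size_skewXnM k 1; rewrite mulr1 => /leq_trans; apply.
  by rewrite size_poly1 /k; lia.
Qed.

End SkewOverDivisionRing.

(** * Linear functionals on skew polynomials and the Sylvester matrix *)

Section Pairing.

Variables (F : divRingType) (s : {rmorphism F -> F}).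
Variables (E : nzRingType) (h : {rmorphism F -> E}).
Implicit Types (p q f g d : skewpoly s) (w : nat -> E).

(** The value at [p] of the left linear functional taking x^i to [w i], scalars acting through
    [h]. *)
Definition pairing p w : E := \sum_(i < size p) h p`_i * w i.

Lemma pairingE m p w : (size p <= m)%N ->
  pairing p w = \sum_(i < m) h p`_i * w i.
Proof.
move=> le_pm; rewrite /pairing (big_ord_widen _ (fun i => h p`_i * w i) le_pm).
rewrite [RHS](bigID (fun i : 'I_m => (i < size p)%N)) /=.
rewrite [X in _ + X]big1 ?addr0 //.
by move=> i; rewrite -leqNgt => le_pi; rewrite nth_default // rmorph0 mul0r.
Qed.

Lemma pairing0 w : pairing 0 w = 0.
Proof. by rewrite /pairing size_poly0 big_ord0. Qed.

Lemma pairingD w : {morph pairing^~ w : p q / p + q}.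
Proof.
move=> p q; pose m := maxn (size p) (size q).
rewrite !(@pairingE m) ?leq_maxl ?leq_maxr ?size_polyD // -big_split.
by apply: eq_bigr => i _ /=; rewrite coefD rmorphD mulrDl.
Qed.

Lemma pairingB w : {morph pairing^~ w : p q / p - q}.
Proof. by move=> p q; apply/eqP; rewrite eq_sym subr_eq -pairingD subrK. Qed.

Lemma pairingCM c p w : pairing (skewC s c * p) w = h c * pairing p w.
Proof.
rewrite (@pairingE (size p)) ?size_skewCM // /pairing mulr_sumr.
by apply: eq_bigr => i _; rewrite coef_skewCM rmorphM mulrA.
Qed.

Lemma pairing_mul p g w :
  (forall i, (i < size p)%N -> pairing (skewX s ^+ i * g) w = 0) ->
  pairing (p * g) w = 0.
Proof.
move=> xg0; rewrite (skewpolyE p) mulr_suml.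
rewrite (big_morph _ (pairingD w) (pairing0 w)) big1 // => i _.
by rewrite -mulrA pairingCM xg0 ?mulr0.
Qed.

Lemma pairing_XM p w : pairing (skewX s * p) w =
  \sum_(i < size p) h (s p`_i) * w i.+1.
Proof.
rewrite (@pairingE (size p).+1) ?(size_skewXnM 1) //.
have coefXM i : (skewX s * p)`_i = if i is j.+1 then s p`_j else 0.
  by rewrite -[skewX s]expr1 coef_skewXnM; case: i => // j; rewrite subn1.
rewrite big_ord_recl coefXM rmorph0 mul0r add0r.
by apply: eq_bigr => i _; rewrite coefXM.
Qed.

Lemma pairing_right_eval (t : {rmorphism E -> E}) (a : E) p :
  right_eval (skewpoly_map t h p) a = pairing p (skew_norm t a).
Proof.
rewrite (@right_evalE _ _ _ _ (size p)) ?size_poly //.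
by apply: eq_bigr => i _; rewrite coef_map_id0 ?rmorph0.
Qed.

(** A column is a functional on polynomials of degree below deg f + deg g; the product with the
    matrix lists its values at the rows. *)
Lemma sylvester_pairing f g w i : f != 0 -> g != 0 ->
  (map_mx h (right_sylvester f g) *m \col_j w j) i 0 =
    pairing (if (i < skew_degree g)%N then skewX s ^+ i * f
             else skewX s ^+ (i - skew_degree g) * g) w.
Proof.
move=> nz_f nz_g; rewrite mxE (@pairingE (skew_degree f + skew_degree g)).
  by apply: eq_bigr => j _; rewrite !mxE; case: ifP.
have := ltn_ord i; move: (nat_of_ord i) => k; rewrite /skew_degree => lt_k.
have Ef : size f = (size f).-1.+1 by rewrite polySpred.
have Eg : size g = (size g).-1.+1 by rewrite polySpred.
by case: ltnP => k_g; apply: leq_trans (size_skewXnM _ _) _; lia.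
Qed.

End Pairing.

(** * Common right divisors from a kernel vector *)

Section CommonDivisor.

Variables (F : divRingType) (s : {rmorphism F -> F}).
Implicit Types (p q r f g d : skewpoly s) (v : nat -> F).

Local Notation pair := (pairing (@idfun F : {rmorphism F -> F})).

(* x^j g for j < m form a triangular system for the entries of v from
   deg g on. *)
Lemma pairing_propagate m g v : g != 0 ->
  (forall j, (j < m)%N -> pair (skewX s ^+ j * g) v = 0) ->
  (forall i, (i < skew_degree g)%N -> v i = 0) ->
  forall i, (i < skew_degree g + m)%N -> v i = 0.
Proof.
move=> nz_g xg0 v0; elim/ltn_ind => i IHi lt_i.
have [lt_ig|le_gi] := ltnP i (skew_degree g); first exact: v0.
pose j := (i - skew_degree g)%N.
have Eg : size g = (skew_degree g).+1 by rewrite /skew_degree polySpred.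
have Ei : i = (j + skew_degree g)%N by rewrite subnK.
have := xg0 j; rewrite (@pairingE _ _ _ _ i.+1); last first.
  by apply: leq_trans (size_skewXnM _ _) _; rewrite Eg Ei addnS.
rewrite big_ord_recr big1 /= => [|k _]; last first.
  by rewrite [v k]IHi ?mulr0 //; apply: ltn_trans lt_i.
have [ge_ij sub_ij] : (i < j)%N = false /\ (i - j)%N = skew_degree g by lia.
rewrite add0r coef_skewXnM ge_ij sub_ij.
have lt_jm : (j < m)%N by rewrite /j ltn_subLR.
move=> /(_ lt_jm)/divring_mulf_eq0[/eqP|//].
by rewrite (negPf (iters_neq0 _ _ _)) // -/(lead_coef g) lead_coef_eq0.
Qed.

(** Euclidean algorithm carrying the functional [v] along: with f = q g + r, the equations for (f,
    g) imply those for (g, r), and [v] stays nonzero in the smaller range. *)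
Lemma common_divisor f g v : f != 0 -> g != 0 ->
  (forall i, (i < skew_degree g)%N -> pair (skewX s ^+ i * f) v = 0) ->
  (forall i, (i < skew_degree f)%N -> pair (skewX s ^+ i * g) v = 0) ->
  (exists2 i, (i < skew_degree f + skew_degree g)%N & v i != 0) ->
  exists d f' g', [/\ (1 < size d)%N, f = f' * d & g = g' * d].
Proof.
have [n] := ubnP (size g); elim: n => // n IHn in f g *.
move=> le_g nz_f nz_g xf0 xg0 [i lt_i nz_vi].
have [q [r [Ef lt_r le_r le_q]]] := skew_division f nz_g.
have sz_f : size f = (skew_degree f).+1 by rewrite /skew_degree polySpred.
have sz_g : size g = (skew_degree g).+1 by rewrite /skew_degree polySpred.
have [r0|nz_r] := eqVneq r 0.
  exists g, q, 1; rewrite mul1r {1}Ef r0 addr0; split=> //.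
  (* For constant [g], its multiples x^j g alone would annihilate all entries of [v]. *)
  rewrite sz_g ltnS lt0n; apply: contra_neq nz_vi => g0.
  apply: (pairing_propagate nz_g xg0); last by rewrite addnC.
  by move=> k; rewrite g0.
have sz_r : size r = (skew_degree r).+1 by rewrite /skew_degree polySpred.
have [|||d [g' [r' [sz_d Eg Er]]]] :=
    IHn g r (leq_trans lt_r le_g) nz_g nz_r.
- by move=> k lt_k; apply: xg0; lia.
- move=> k lt_k; have -> : r = f - q * g by rewrite {1}Ef addrAC subrr add0r.
  rewrite mulrBr pairingB xf0 // mulrA pairing_mul ?subr0 // => j.
  (* For nonzero [q] the subtraction in the size bound is not truncated, and x^k q has degree below
     that of [f]. *)
  have [->|nz_q] := eqVneq q 0; first by rewrite mulr0 size_poly0.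
  have gt0_q : (0 < size q)%N by rewrite size_poly_gt0.
  move=> lt_j; apply: xg0; have := leq_trans lt_j (size_skewXnM _ _).
  by lia.
- have [//|all0] := pselect (exists2 i,
    (i < skew_degree g + skew_degree r)%N & v i != 0).
  (* If [v] vanished below deg g + deg r, the equations of [g] would propagate this up to deg f +
     deg g. *)
  case/eqP: nz_vi; apply: (pairing_propagate nz_g xg0); last by rewrite addnC.
  move=> k lt_k; apply/eqP/negPn/negP => nz_vk.
  by apply: all0; exists k => //; rewrite ltn_addr.
exists d, (q * g' + r'), g'; split=> //.
by rewrite mulrDl -mulrA -Eg -Er.
Qed.

End CommonDivisor.

(** * Adjoining a right root *)

Section RootExtension.

Variables (F : divRingType) (s : {rmorphism F -> F}) (u : F).
Hypothesis u_neq0 : u != 0.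
Hypothesis s_inner : forall a : F, s a = u^-1 * a * u.
Variable d : skewpoly s.
Hypothesis size_d : (1 < size d)%N.
Hypothesis d0_neq0 : d`_0 != 0.

Let d_neq0 : d != 0.
Proof. by rewrite -size_poly_gt0 (leq_trans _ size_d). Qed.

Lemma skew_multiple_small (q r : skewpoly s) :
  r = q * d -> (size r < size d)%N -> r = 0.
Proof.
have [-> ->|nz_q ->] := eqVneq q 0; first by rewrite mul0r.
by rewrite size_skewM // (polySpred nz_q) addSn /= ltnNge leq_addl.
Qed.

Variables (D : divRingType) (h0 : {rmorphism F -> D}).
Hypothesis infinite_center :
  forall l : seq D, exists2 c, central c & c \notin l.

Let U := h0 u.
Let U_unit : U \is a GRing.unit.
Proof. by apply/rmorph_unit/divring_axiom. Qed.

Let h0s a : h0 (s a) = U^-1 * h0 a * U.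
Proof. by rewrite s_inner !rmorphM rmorphV //; exact: divring_axiom. Qed.

(* The D-valued functionals w on F[x;s], given by w i = w(x^i), that vanish on
   the left ideal of d. *)
Definition solutions : set (nat -> D) :=
  [set w | forall m, pairing h0 (skewX s ^+ m * d) w = 0].

Definition twisted_shift (w : nat -> D) : nat -> D :=
  fun i => U * w i.+1 * U^-1.

Lemma pairing_line (p : skewpoly s) w v c : central c ->
  pairing h0 p (line w v c) = pairing h0 p w + c * pairing h0 p v.
Proof.
move=> Cc; rewrite /pairing mulr_sumr -big_split; apply: eq_bigr => i _ /=.
by rewrite mulrDr !mulrA Cc.
Qed.

Lemma solutions_line w v c : solutions w -> solutions v -> central c ->
  solutions (line w v c).
Proof. by move=> sw sv Cc m; rewrite pairing_line // sw sv mulr0 addr0. Qed.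

(** Conjugation by [U] undoes [s] on the coefficients, because [s] is inner. Up to this conjugation,
    the shift is thus the transpose of left multiplication by x and preserves [solutions]. *)
Lemma pairing_twisted_shift (p : skewpoly s) w :
  pairing h0 p (twisted_shift w) = U * pairing h0 (skewX s * p) w * U^-1.
Proof.
rewrite pairing_XM mulr_sumr mulr_suml; apply: eq_bigr => i _.
by rewrite h0s /twisted_shift !mulrA divrr // mul1r.
Qed.

Lemma twisted_shift_solutions w : solutions w -> solutions (twisted_shift w).
Proof.
move=> sw m; rewrite pairing_twisted_shift mulrA -exprS sw.
by rewrite mulr0 mul0r.
Qed.

Lemma twisted_shift_line w v c : central c ->
  twisted_shift (line w v c) = line (twisted_shift w) (twisted_shift v) c.
Proof.
move=> Cc; apply: funext => i; rewrite /twisted_shift /line.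
by rewrite mulrDr mulrDl !mulrA Cc.
Qed.

(** A preimage is the unshifted sequence preceded by a term [w0], solved from the equation of [d]
    itself since its constant coefficient is invertible. The equations of x^m d for m > 0 come from
    those of [w]. *)
Lemma twisted_shift_surj w : solutions w ->
  exists2 w', solutions w' & twisted_shift w' = w.
Proof.
move=> sw; pose tail i := U^-1 * w i * U.
pose w0 := - ((h0 d`_0)^-1 * \sum_(i < (size d).-1) h0 d`_i.+1 * tail i).
pose w' i := if i is j.+1 then tail j else w0.
have Tw' : twisted_shift w' = w.
  apply: funext => i; rewrite /twisted_shift /= /tail.
  by rewrite !mulrA divrr // mul1r mulrK.
exists w' => // m; case: m => [|m]; last first.
  have := sw m; rewrite -{1}Tw' pairing_twisted_shift mulrA -exprS.
  move=> /(congr1 (fun c => U^-1 * c * U)).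
  by rewrite !mulrA mulVr // mul1r mulrVK // mulr0 mul0r.
rewrite mul1r (@pairingE _ _ _ _ (size d).-1.+1); last by rewrite -polySpred.
rewrite big_ord_recl /= mulrN mulrA divrr ?mul1r ?addNr //.
exact/rmorph_unit/divring_axiom.
Qed.

(* w i is the constant coefficient of the remainder of x^i modulo d. *)
Lemma solution_neq0 : exists2 w, solutions w & w 0 != 0.
Proof.
have rem_ex i : exists r, exists2 q,
    skewX s ^+ i = q * d + r & (size r < size d)%N.
  have [q [r [E lt_r _ _]]] := skew_division (skewX s ^+ i) d_neq0.
  by exists r, q.
pose rem i := sval (cid (rem_ex i)).
have remP i : exists2 q, skewX s ^+ i = q * d + rem i &
    (size (rem i) < size d)%N.
  by rewrite /rem; case: cid.
have d_gt0 : (0 < size d)%N by rewrite size_poly_gt0.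
exists (fun i => h0 (rem i)`_0) => [m|].
  (* [R] is congruent to [p], hence to 0, modulo the left ideal of [d], and has smaller degree than
     [d], so it vanishes. The pairing is the image of its constant coefficient. *)
  set p := _ * d; pose R := \sum_(i < size p) skewC s p`_i * rem i.
  have R0 : R = 0.
    have sz_R : (size R < size d)%N.
      rewrite /R; elim/big_ind: _ => [|a b lt_a lt_b|i _].
      - by rewrite size_poly0.
      - by apply: leq_ltn_trans (size_polyD _ _) _; rewrite gtn_max lt_a.
      - have [_ _ lt_r] := remP i.
        exact: leq_ltn_trans (size_skewCM _ _) lt_r.
    have [Q EQ] : exists Q, p - R = Q * d.
      rewrite {1}(skewpolyE p) /R -sumrB.
      elim/big_ind: _ => [|a b [q ->] [r ->]|i _].
      - by exists 0; rewrite mul0r.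
      - by exists (q + r); rewrite mulrDl.
      - have [q Eq _] := remP i; exists (skewC s p`_i * q).
        by rewrite -mulrBr Eq addrK mulrA.
    apply: (@skew_multiple_small (skewX s ^+ m - Q)) => //.
    by rewrite mulrBl -EQ -/p opprB addrC subrK.
  transitivity (h0 R`_0); last by rewrite R0 coef0 rmorph0.
  rewrite /pairing /R coef_sum rmorph_sum; apply: eq_bigr => i _.
  by rewrite coef_skewCM rmorphM.
have [q E0 lt_r] := remP 0%N.
suff -> : rem 0 = 1 by rewrite coefC rmorph1 oner_neq0.
apply/eqP; rewrite eq_sym -subr_eq0; apply/eqP.
apply: (@skew_multiple_small q); first by rewrite -(expr0 (skewX s)) E0 addrK.
apply: leq_ltn_trans (size_polyD _ _) _.
by rewrite size_polyN gtn_max lt_r size_poly1 size_d.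
Qed.

(** The coordinate germs satisfy t(Y_i) = Y_(i+1), so alpha = Y_1 / Y_0 has norms Y_i / Y_0. The
    evaluation of q d at alpha, times Y_0, is the germ of the pairing of q d with [w], which is zero
    at each solution. *)
Lemma root_extension_over :
  exists (E : divRingType) (t : {rmorphism E -> E}) (h : {rmorphism F -> E}),
    (forall a : F, t (h a) = h (s a)) /\
    exists alpha : E, forall q : skewpoly s,
      right_eval (skewpoly_map t h (q * d)) alpha = 0.
Proof.
have sol_neq0 : exists w, solutions w.
  by have [w sw _] := solution_neq0; exists w.
have [E [pi [piS piP pi1 piD piM]]] :=
  rational_field sol_neq0 solutions_line infinite_center.
pose rat := @rational D nat solutions.
have ratC a : rat (fun=> a) by exact: rational_const sol_neq0 solutions_line a.
have ratX i : rat (fun w => w i).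
  exact: rational_coord sol_neq0 solutions_line i.
have ratM f g : rat f -> rat g -> rat (fun w => f w * g w).
  exact: (rationalM solutions_line infinite_center).
have ratD f g : rat f -> rat g -> rat (fun w => f w + g w).
  exact: (rationalD solutions_line infinite_center).
have pi0 : pi (fun=> 0) = 0.
  apply: (addrI (pi (fun=> 0))); rewrite addr0 -(piD _ _ (ratC _) (ratC _)).
  by congr pi; apply: funext => w; rewrite addr0.
(* conjugation by u of f composed with the shift: it sends w |-> w i to
   w |-> w i.+1 *)
pose twist (f : (nat -> D) -> D) w := U^-1 * f (twisted_shift w) * U.
have rat_twist f : rat f -> rat (twist f).
  move=> rf; refine (ratM _ _ (ratM _ _ (ratC _) _) (ratC U)).
  exact (rational_comp solutions_line twisted_shift_solutions
    twisted_shift_line twisted_shift_surj rf).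
pose rep e := s2val (cid2 (piS e)).
have rat_rep e : rat (rep e) by rewrite /rep; case: cid2.
have repK e : pi (rep e) = e by rewrite /rep; case: cid2.
(* The map is defined on chosen representatives; independence of the choice holds because preimages
   of generic sets under the shift are generic. *)
have [t0 t0E] : exists t0 : E -> E, forall f, rat f ->
    t0 (pi f) = pi (twist f).
  exists (fun e => pi (twist (rep e))) => f rf.
  apply/piP; [exact: rat_twist | exact: rat_twist |].
  have rep_eq := (piP _ _ (rat_rep (pi f)) rf).1 (repK (pi f)).
  have [O genO E0] := generic_eq_comp solutions_line twisted_shift_solutions
    twisted_shift_line twisted_shift_surj rep_eq.
  by exists O => // w /E0 E1; rewrite /twist; congr (_ * _ * _); exact: E1.
have t0D a b : t0 (a + b) = t0 a + t0 b.
  have [f rf <-] := piS a; have [g rg <-] := piS b.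
  have [rfg rtf rtg] := And3 (ratD f g rf rg) (rat_twist f rf) (rat_twist g rg).
  rewrite -piD // !t0E // -piD //.
  by congr pi; apply: funext => w; rewrite /twist mulrDr mulrDl.
have t0B : zmod_morphism t0.
  by move=> a b; apply/eqP; rewrite eq_sym subr_eq -t0D subrK.
have t0M : monoid_morphism t0.
  split=> [|a b].
    rewrite -pi1 t0E //; congr pi; apply: funext => w.
    by rewrite /twist mulr1 mulVr.
  have [f rf <-] := piS a; have [g rg <-] := piS b.
  have [rfg rtf rtg] := And3 (ratM f g rf rg) (rat_twist f rf) (rat_twist g rg).
  rewrite -piM // !t0E // -piM //.
  congr pi; apply: funext => w; rewrite /twist !mulrA; congr (_ * _ * _).
  by rewrite mulrK.
pose t : {rmorphism E -> E} := HB.pack t0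
  (GRing.isZmodMorphism.Build E E t0 t0B)
  (GRing.isMonoidMorphism.Build E E t0 t0M).
pose c0 (a : F) : E := pi (fun=> h0 a).
have c0B : zmod_morphism c0.
  move=> a b; apply/eqP; rewrite eq_sym subr_eq -(piD _ _ (ratC _) (ratC _)).
  apply/eqP.
  by congr pi; apply: funext => w; rewrite -rmorphD subrK.
have c0M : monoid_morphism c0.
  split=> [|a b]; first by rewrite /c0 rmorph1 pi1.
  by rewrite -(piM _ _ (ratC _) (ratC _)) /c0 rmorphM.
pose h : {rmorphism F -> E} := HB.pack c0
  (GRing.isZmodMorphism.Build F E c0 c0B)
  (GRing.isMonoidMorphism.Build F E c0 c0M).
pose Y i : E := pi (fun w => w i).
have tY i : t (Y i) = Y i.+1.
  rewrite [LHS]t0E //; congr pi; apply: funext => w.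
  by rewrite /twist /twisted_shift !mulrA mulVr // mul1r mulrVK.
have Y0_neq0 : Y 0 != 0.
  rewrite -pi0; apply/eqP => /piP Y0.
  have := coord_neq0 sol_neq0 solutions_line.
  move=> /(_ infinite_center 0 solution_neq0); apply; apply: Y0.
    exact: ratX.
  exact: ratC.
exists E, t, h; split=> [a|].
  rewrite [LHS]t0E //; congr pi; apply: funext => w.
  by rewrite h0s.
have UY0 : Y 0 \is a GRing.unit by exact: divring_axiom.
exists (Y 1 / Y 0) => q; apply: (mulIr UY0); rewrite mul0r.
have normY i : skew_norm t (Y 1 / Y 0) i * Y 0 = Y i.
  have iterY j k : iter j t (Y k) = Y (j + k)%N.
    by elim: j => // j IHj; rewrite iterS IHj tY.
  elim: i => [|i IHi]; first by rewrite mul1r.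
  rewrite [skew_norm _ _ _]/(_ * _) -mulrA IHi -{2}[i]addn0 -iterY.
  rewrite -iters_multiplicative mulrVK //.
  by rewrite iterY addn1.
rewrite pairing_right_eval /pairing mulr_suml.
under eq_bigr => i _ do rewrite -mulrA normY.
set p := q * d.
(* Rationality of the partial sums is carried in the induction, since [pi] is additive on rational
   functions. *)
have sumY n : rat (fun w => \sum_(i < n) h0 p`_i * w i) /\
    pi (fun w => \sum_(i < n) h0 p`_i * w i) = \sum_(i < n) h p`_i * Y i.
  elim: n => [|n [ratn IHn]].
    rewrite big_ord0 (_ : (fun w => _) = fun=> 0) //.
    by apply: funext => w; rewrite big_ord0.
  have ratn1 := ratM _ _ (ratC (h0 p`_n)) (ratX n).
  rewrite big_ord_recr -IHn -[h _]/(pi (fun=> h0 p`_n)).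
  rewrite -(piM _ _ (ratC _) (ratX _)) /= -(piD _ _ ratn ratn1).
  suff -> : (fun w : nat -> D => \sum_(i < n.+1) h0 p`_i * w i) =
      (fun w => \sum_(i < n) h0 p`_i * w i + h0 p`_n * w n).
    by split=> //; exact: ratD.
  by apply: funext => w; rewrite big_ord_recr.
rewrite -(sumY _).2 -pi0; apply/piP; [exact: (sumY _).1 | exact: ratC |].
exists solutions; first exact: generic_setT sol_neq0 solutions_line.
by move=> w sw; apply: pairing_mul => i _; exact: sw.
Qed.

End RootExtension.

(** The root serves all left multiples of [d] at once. If [d] has constant coefficient 0, so do its
    left multiples, and 0 is already a root in [F]. *)
Lemma root_extension (F : divRingType) (s : {rmorphism F -> F}) (u : F)
    (d : skewpoly s) : u != 0 -> (forall a : F, s a = u^-1 * a * u) ->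
    (1 < size d)%N ->
  exists (E : divRingType) (t : {rmorphism E -> E}) (h : {rmorphism F -> E}),
    (forall a : F, t (h a) = h (s a)) /\
    exists alpha : E, forall q : skewpoly s,
      right_eval (skewpoly_map t h (q * d)) alpha = 0.
Proof.
move=> nz_u s_inner sz_d; have [d0|nz_d0] := eqVneq d`_0 0; last first.
  have [D [h0 infC]] := infinite_center_extension F.
  exact: root_extension_over nz_u s_inner d sz_d nz_d0 D h0 infC.
exists F, s, (idfun : {rmorphism F -> F}); split=> //; exists 0 => q.
rewrite pairing_right_eval (@pairingE _ _ _ _ (size (q * d)%R).+1) //.
rewrite big_ord_recl /= coef_skewM big_ord1 d0 mulr0 mul0r add0r big1 // => i _.
by rewrite /= iters0 mul0r mulr0.
Qed.

(** * Resultants and common right roots *)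

(** Elimination uses ring operations, inverses of pivots and tests for zero; [h] is injective, so
    the same pivots are chosen. *)
Lemma dieudonne_rep_map (F E : divRingType) (h : {rmorphism F -> E}) n
    (A : 'M[F]_n) : dieudonne_rep (map_mx h A) = h (dieudonne_rep A).
Proof.
elim: n A => [|n IHn] A /=; first by rewrite rmorph1.
have Eh i : (map_mx h A i 0 != 0) = (A i 0 != 0).
  by rewrite mxE -(rmorph0 h) (inj_eq (@divring_morph_inj _ _ h)).
rewrite (eq_pick Eh); case: pickP => [i nz_i|_]; last by rewrite rmorph0.
rewrite !rmorphM rmorphXn rmorphN1 -IHn mxE; congr (_ * dieudonne_rep _).
apply/matrixP => k j; rewrite !mxE rmorphB !rmorphM rmorphV //.
exact: divring_axiom.
Qed.

Theorem proposition3p25 (F : divRingType) (F_infinite : infinite_set [set: F])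
    (s : {rmorphism F -> F}) (u : F) (u_neq0 : u != 0)
    (s_inner : forall a : F, s a = u^-1 * a * u)
    (f g : skewpoly s) (f_neq0 : f != 0) (g_neq0 : g != 0) :
  (exists (E : divRingType) (t : {rmorphism E -> E}) (h : {rmorphism F -> E}),
     (forall a : F, t (h a) = h (s a)) /\
     exists alpha : E,
       right_eval (skewpoly_map t h f) alpha = 0 /\
       right_eval (skewpoly_map t h g) alpha = 0)
  <-> right_resultant f g = dieudonne_zero F.
Proof.
split=> [[E [t [h [th [a [fa0 ga0]]]]]]|].
  have evalM (p q : skewpoly s) : right_eval (skewpoly_map t h q) a = 0 ->
      right_eval (skewpoly_map t h (p * q)) a = 0.
    move=> /right_evalP[r Er]; apply/right_evalP.
    exists (skewpoly_map t h p * r).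
    by rewrite skewpoly_mapM // Er skewC0 !addr0 mulrA.
  (* Singularity over [E] descends to [F], the representative over [E] being the image under [h] of
     the one over [F]. *)
  suff /dieudonne_det_eq0/dieudonne_class_eq0 : exists2 v : 'cV[E]_(_),
      v != 0 & map_mx h (right_sylvester f g) *m v = 0.
    rewrite dieudonne_rep_map => hdet0; apply/dieudonne_class_eq0.
    by apply: (@divring_morph_inj _ _ h); rewrite hdet0 rmorph0.
  (* A nonzero constant has no root, so the matrix is not empty and the vector of norms has a first
     entry, equal to 1. *)
  have degs : (0 < skew_degree f + skew_degree g)%N.
    rewrite addn_gt0 lt0n; case: eqVneq => //= f_deg0; exfalso.
    have sz_f : size f = 1 := etrans (polySpred f_neq0) (congr1 S f_deg0).
    move: fa0; rewrite pairing_right_eval /pairing sz_f big_ord1 mulr1.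
    rewrite -(rmorph0 h) => /(@divring_morph_inj _ _ h)/eqP.
    have -> : f`_0 = lead_coef f by rewrite lead_coefE sz_f.
    by rewrite lead_coef_eq0 (negPf f_neq0).
  exists (\col_j skew_norm t a j).
    apply/eqP => /matrixP/(_ (Ordinal degs) 0); rewrite !mxE => /eqP.
    by rewrite oner_eq0.
  apply/matrixP => i o; rewrite ord1 sylvester_pairing // [RHS]mxE.
  by rewrite -pairing_right_eval; case: ifP => _; exact: evalM.
move=> /dieudonne_det_eq0[v nz_v Sv0].
(* The kernel vector is extended by zero to a sequence, that is, to a functional on all skew
   polynomials. *)
pose w k := if insub k is Some j then v j 0 else 0.
have vE : v = \col_j w j.
  by apply/matrixP => j o; rewrite ord1 mxE /w valK.
have row i := sylvester_pairing (idfun : {rmorphism F -> F}) w i f_neq0 g_neq0.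
have {}row (i : 'I_(skew_degree f + skew_degree g)) :
    pairing (idfun : {rmorphism F -> F})
      (if (i < skew_degree g)%N then skewX s ^+ i * f
       else skewX s ^+ (i - skew_degree g) * g) w = 0.
  by rewrite -row map_mx_id // -vE Sv0 mxE.
have [|||d [f' [g' [sz_d Ef Eg]]]] := @common_divisor _ _ f g w f_neq0 g_neq0.
- move=> i lt_i; have lt_i' : (i < skew_degree f + skew_degree g)%N.
    by rewrite ltn_addl.
  by have := row (Ordinal lt_i'); rewrite /= lt_i.
- move=> i lt_i.
  have lt_i' : (skew_degree g + i < skew_degree f + skew_degree g)%N.
    by rewrite addnC ltn_add2r.
  by have := row (Ordinal lt_i'); rewrite /= ltnNge leq_addr /= addKn.
- have [i nz_vi] : exists i, v i 0 != 0.
    have [//|all0] := pselect (exists i, v i 0 != 0).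
    case/eqP: nz_v; apply/matrixP => i o; rewrite ord1 mxE.
    by apply/eqP/negPn/negP => vi; apply: all0; exists i.
  by exists i => //; rewrite /w valK.
have [E [t [h [th [a da]]]]] := root_extension u_neq0 s_inner sz_d.
by exists E, t, h; split=> //; exists a; rewrite Ef Eg.
Qed.
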